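(* Let $\phi:\mathbb{R}^n\times\mathbb{Z}^n\to\mathbb{R}$ and $a:\mathbb{T}^n\times\mathbb{Z}^n\to\mathbb{C}$ be such that $\phi(\cdot,k)$ and $a(\cdot,k)$ are of class $C^{2n+1}$ for every $k\in\mathbb{Z}^n$, and let $T:C^\infty(\mathbb{T}^n)\to\mathcal{D}'(\mathbb{T}^n)$ be defined by $$Tu(x)=\sum_{k\in\mathbb{Z}^n}e^{i\phi(x,k)}\,a(x,k)\,(\mathcal{F}_{\mathbb{T}^n}u)(k).$$ Assume that the function $x\mapsto e^{i\phi(x,\xi)}$ is $2\pi$-periodic for every $\xi\in\mathbb{Z}^n$, and that there is a constant $C>0$ such that for all $\alpha,\beta\in\mathbb{N}_0^n$ with $|\alpha|\le 2n+1$ and $|\beta|=1$ $$|\partial_x^\alpha a(x,k)|\le C\quad\text{and}\quad|\partial_x^\alpha\triangle_k^\beta\phi(x,k)|\le C\quad\text{for all }(x,k)\in\mathbb{T}^n\times\mathbb{Z}^n.$$ Assume also that there is a constant $C>0$ such that $$|\nabla_x\phi(x,k)-\nabla_x\phi(x,l)|\ge C|k-l|\quad\text{for all }x\in\mathbb{T}^n,\ k,l\in\mathbb{Z}^n.$$ Then $T$ extends to a bounded operator on $L^2(\mathbb{T}^n)$.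
   Context: $\mathbb{T}^n=(\mathbb{R}/2\pi\mathbb{Z})^n$, identified with the cube $[0,2\pi)^n$; functions on $\mathbb{T}^n$ are identified with $2\pi$-periodic functions on $\mathbb{R}^n$. For the (not necessarily periodic) function $\phi$, bounds ''for $x\in\mathbb{T}^n$'' are understood for $x$ in this cube. $\mathcal{D}'(\mathbb{T}^n)$ is the space of distributions on $\mathbb{T}^n$. $(\mathcal{F}_{\mathbb{T}^n}u)(k)=\int_{\mathbb{T}^n}e^{-ix\cdot k}u(x)\,(2\pi)^{-n}\mathrm{d}x$ for $k\in\mathbb{Z}^n$. For $|\beta|=1$, $\beta=e_j$, $\triangle_k^{\beta}\phi(x,k)=\phi(x,k+e_j)-\phi(x,k)$. *)

(* Defs.v *)
From HB Require Import structures.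
From mathcomp Require Import all_boot all_order all_algebra finmap complex.
From mathcomp Require Import all_classical all_reals all_analysis.

Set Implicit Arguments.
Unset Strict Implicit.
Unset Printing Implicit Defensive.

Import Order.TTheory GRing.Theory Num.Theory.
Import numFieldNormedType.Exports.
Import complex.

Local Open Scope classical_set_scope.
Local Open Scope ring_scope.
Local Open Scope complex_scope.

(* Row vectors carry the sigma-algebra generated by the coordinates; for       *)
(* 'rV[R]_n this is the Borel sigma-algebra.                                   *)
Section measurable_rV.
Context (R : realType) (n : nat).

Definition rV_coord (i : 'I_n) (x : 'rV[R]_n) : R := x ord0 i.

Definition rV_measurable : set (set 'rV[R]_n) := g_sigma_preimage rV_coord.

Let rV_measurable0 : rV_measurable set0.
Proof. exact: sigma_algebra0. Qed.

Let rV_measurableC A : rV_measurable A -> rV_measurable (~` A).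
Proof. exact: sigma_algebraC. Qed.

Let rV_measurable_bigcup (F : (set 'rV[R]_n)^nat) :
  (forall i, rV_measurable (F i)) -> rV_measurable (\bigcup_i (F i)).
Proof. exact: sigma_algebra_bigcup. Qed.

HB.instance Definition _ := @isMeasurable.Build default_measure_display
  'rV[R]_n rV_measurable rV_measurable0 rV_measurableC rV_measurable_bigcup.

Lemma measurable_rV_coord i : measurable_fun setT (rV_coord i).
Proof.
move=> _ Y mY; rewrite setTI; apply: sub_sigma_algebra => /=.
rewrite -bigcup_seq/=; exists i => /=; first by rewrite mem_index_enum.
by exists Y => //; rewrite setTI.
Qed.

Lemma measurable_fun_rV d (T : measurableType d) (f : T -> 'rV[R]_n) :
  (forall i, measurable_fun setT (rV_coord i \o f)) -> measurable_fun setT f.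
Proof.
move=> mf.
have sub : g_sigma_preimage (fun i => rV_coord i \o f) `<=` measurable.
  apply: smallest_sub; first exact: sigma_algebra_measurable.
  elim/big_rec: _ => [A []|i B _ IH A].
  by move=> [[C mC <-]|/IH//]; rewrite setTI -[X in measurable X]setTI; exact: mf.
move=> _ Y mY; rewrite setTI; apply: sub.
by rewrite g_sigma_preimage_comp; exists Y => //; rewrite setTI.
Qed.

End measurable_rV.

(* The measure dx on the cube [0, 2 pi)^n, defined on 'rV[R]_n as the n-fold   *)
(* product of the restriction to [0, 2 pi) of the Lebesgue measure.            *)
Section torus_measure.
Context (R : realType).

Let circle : set (measurableTypeR R) := `[0, 2 * pi[.

Let measurable_circle : measurable circle.
Proof. exact: measurable_itv. Qed.

Let circle_fin : (lebesgue_measure circle < +oo)%E.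
Proof. by rewrite lebesgue_measure_itv/=; case: ifP => _; rewrite ?ltry. Qed.

Definition circle_measure : set (measurableTypeR R) -> \bar R :=
  mfrestr measurable_circle circle_fin.

HB.instance Definition _ := FiniteMeasure.on circle_measure.

Definition rV_cons n (p : measurableTypeR R * 'rV[R]_n) : 'rV[R]_n.+1 :=
  row_mx (const_mx (p.1 : R) : 'rV_1) p.2.

Lemma measurable_rV_cons n : measurable_fun setT (@rV_cons n).
Proof.
apply: measurable_fun_rV => i.
case: (split_ordP (i : 'I_(1 + n))) => j ij.
- rewrite (_ : _ \o _ = fst)//; apply/funext => p /=.
  by rewrite /rV_coord ij; apply: (etrans (row_mxEl _ _ _ _)); rewrite mxE.
- rewrite (_ : _ \o _ = rV_coord j \o snd); last first.
    by apply/funext => p /=; rewrite /rV_coord ij; exact: row_mxEr.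
  by apply: measurableT_comp => //; exact: measurable_rV_coord.
Qed.

Section rV_prod.
Context n (mu : {finite_measure set 'rV[R]_n -> \bar R}).

Definition rV_prod : set 'rV[R]_n.+1 -> \bar R :=
  pushforward (circle_measure \x mu)%E (@rV_cons n).

Let rV_prod0 : rV_prod set0 = 0%E.
Proof. by rewrite /rV_prod /pushforward preimage_set0 measure0. Qed.

Let rV_prod_ge0 A : (0 <= rV_prod A)%E.
Proof. exact: (measure_ge0 (circle_measure \x mu)%E). Qed.

Let rV_prod_sigma_additive : semi_sigma_additive rV_prod.
Proof.
pose m : {measure set _ -> \bar R} := (circle_measure \x mu)%E.
move=> F mF tF mUF; rewrite /rV_prod /pushforward preimage_bigcup.
have mpre A : measurable A -> measurable (@rV_cons n @^-1` A).
  by move=> mA; rewrite -[X in measurable X]setTI; exact: measurable_rV_cons.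
apply: (@measure_semi_sigma_additive _ _ _ m).
- by move=> i; exact: mpre.
- apply/trivIsetP => /= i j _ _ ij; rewrite -preimage_setI.
  by move/trivIsetP : tF => /(_ _ _ _ _ ij) ->//; rewrite preimage_set0.
- by rewrite -preimage_bigcup; exact: mpre.
Qed.

HB.instance Definition _ := isMeasure.Build _ _ _ rV_prod
  rV_prod0 rV_prod_ge0 rV_prod_sigma_additive.

Let rV_prod_fin : fin_num_fun rV_prod.
Proof.
move=> U mU; rewrite ge0_fin_numE ?measure_ge0//.
apply: (@le_lt_trans _ _ (rV_prod setT)); first by rewrite le_measure// inE.
rewrite /rV_prod /pushforward preimage_setT -setXTT product_measure1E//.
by rewrite lte_mul_pinfty// ?fin_num_measure// ltey_eq fin_num_measure.
Qed.

HB.instance Definition _ := Measure_isFinite.Build _ _ _ rV_prod rV_prod_fin.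

End rV_prod.

Fixpoint torus_measure n : {finite_measure set 'rV[R]_n -> \bar R} :=
  match n with
  | 0 => \d_(0 : 'rV[R]_0)
  | n'.+1 => rV_prod (torus_measure n')
  end.

End torus_measure.

Section torus_calculus.
Context (R : realType) (n : nat).
Implicit Types (x : 'rV[R]_n) (k l : 'rV[int]_n).

Definition cnorm : R[i] -> R := @ComplexField.Normc.normc R.

Definition enorm x : R := Num.sqrt (\sum_(j < n) x ord0 j ^+ 2).

Definition latticeR k : 'rV[R]_n := map_mx intr k.

Definition dot x k : R := \sum_(j < n) x ord0 j * (k ord0 j)%:~R.

(* exp (i t) *)
Definition expi (t : R) : R[i] := cos t +i* sin t.

Definition unit_vec (j : 'I_n) : 'rV[R]_n := delta_mx ord0 j.

Definition cube : set 'rV[R]_n :=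
  [set x : 'rV[R]_n | forall j, 0 <= x ord0 j < 2 * pi].

Definition torus_periodic (f : 'rV[R]_n -> R[i]) : Prop :=
  forall j x, f (x + (2 * pi) *: unit_vec j) = f x.

Definition partial (j : 'I_n) (f : 'rV[R]_n -> R) : 'rV[R]_n -> R :=
  fun x => 'D_(unit_vec j) f x.

Definition grad (f : 'rV[R]_n -> R) x : 'rV[R]_n := \row_j partial j f x.

Definition msize (alpha : 'I_n -> nat) : nat := (\sum_(j < n) alpha j)%N.

Definition mpartial (alpha : 'I_n -> nat) (f : 'rV[R]_n -> R) :
    'rV[R]_n -> R :=
  foldr (fun j g => iter (alpha j) (partial j) g) f (enum 'I_n).

Fixpoint Cdiff (m : nat) (f : 'rV[R]_n -> R) : Prop :=
  continuous f /\
  if m is m'.+1 then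
    forall j, (forall x, derivable f x (unit_vec j)) /\ Cdiff m' (partial j f)
  else True.

(* Complex-valued functions are differentiated componentwise. *)
Definition Cdiffc (m : nat) (f : 'rV[R]_n -> R[i]) : Prop :=
  Cdiff m (fun x => Re (f x)) /\ Cdiff m (fun x => Im (f x)).

Definition mpartialc (alpha : 'I_n -> nat) (f : 'rV[R]_n -> R[i]) :
    'rV[R]_n -> R[i] :=
  fun x => mpartial alpha (fun y => Re (f y)) x +i*
           mpartial alpha (fun y => Im (f y)) x.

(* The difference operator in k, for the multi-index beta = e_j. *)
Definition diffk (j : 'I_n) (phi : 'rV[R]_n -> 'rV[int]_n -> R) :
    'rV[R]_n -> 'rV[int]_n -> R :=
  fun x k => phi x (k + delta_mx ord0 j) - phi x k.

Local Notation mu := (torus_measure R n).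

Definition torus_integrable (f : 'rV[R]_n -> R[i]) : Prop :=
  mu.-integrable setT (fun x => (Re (f x))%:E) /\
  mu.-integrable setT (fun x => (Im (f x))%:E).

Definition torus_int (f : 'rV[R]_n -> R[i]) : R[i] :=
  (\int[mu]_x Re (f x)) +i* (\int[mu]_x Im (f x)).

Definition fourier (u : 'rV[R]_n -> R[i]) k : R[i] :=
  torus_int (fun x => expi (- dot x k) * u x * ((2 * pi) ^- n)%:C).

(* The family F is unconditionally summable over Z^n, with sum s. *)
Definition lattice_sum (F : 'rV[int]_n -> R[i]) (s : R[i]) : Prop :=
  forall e : R, 0 < e -> exists J : {fset 'rV[int]_n},
    forall K : {fset 'rV[int]_n}, fsubset J K ->
      cnorm (\sum_(k <- K) F k - s) < e.

(* C^oo(T^n) *)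
Record torus_smooth := TorusSmooth {
  smooth_fun :> 'rV[R]_n -> R[i];
  smooth_periodic : torus_periodic smooth_fun;
  smooth_Cdiffc : forall m, Cdiffc m smooth_fun }.

Definition smooth_cvg (v_ : nat -> torus_smooth) (v : torus_smooth) : Prop :=
  forall (alpha : 'I_n -> nat) (e : R), 0 < e ->
    \forall i \near \oo, forall x,
      cnorm (mpartialc alpha (v_ i) x - mpartialc alpha v x) <= e.

(* D'(T^n): linear functionals on C^oo(T^n), continuous for the uniform        *)
(* convergence of all derivatives. As C^oo(T^n) is metrizable, sequential      *)
(* continuity is continuity.                                                   *)
Record torus_distribution := TorusDistribution {
  pairing :> torus_smooth -> R[i];
  pairing_linear : forall (c : R[i]) (u v w : torus_smooth),
    (forall x, w x = c * u x + v x) -> pairing w = c * pairing u + pairing v;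
  pairing_continuous : forall (v_ : nat -> torus_smooth) (v : torus_smooth),
    smooth_cvg v_ v ->
    (fun i => cnorm (pairing (v_ i) - pairing v)) @ \oo --> (0 : R) }.

(* L is the regular distribution v |-> int g v dx. *)
Definition is_function (L : torus_distribution) (g : 'rV[R]_n -> R[i]) : Prop :=
  torus_integrable g /\
  forall v : torus_smooth, L v = torus_int (fun x => g x * v x).

(* T u is the function x |-> sum_k exp (i phi(x, k)) a(x, k) (F u)(k), the      *)
(* series being unconditionally convergent at every point.                     *)
Definition is_fio (phi : 'rV[R]_n -> 'rV[int]_n -> R)
    (a : 'rV[R]_n -> 'rV[int]_n -> R[i])
    (T : torus_smooth -> torus_distribution) : Prop :=
  forall u : torus_smooth, exists Tu : 'rV[R]_n -> R[i],
    (forall x,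
      lattice_sum (fun k => expi (phi x k) * a x k * fourier u k) (Tu x)) /\
    is_function (T u) Tu.

(* Elements of L^2(T^n) are handled through representatives defined on R^n, of *)
(* which only the almost everywhere class on the cube matters.                 *)
Definition L2 (f : 'rV[R]_n -> R[i]) : Prop :=
  (fun x => Re (f x)) \in Lfun mu 2%:E /\ (fun x => Im (f x)) \in Lfun mu 2%:E.

Definition L2norm (f : 'rV[R]_n -> R[i]) : \bar R :=
  Lnorm mu 2%:E (fun x => (cnorm (f x))%:E).

(* Compatibility of S with almost everywhere equality follows from linearity   *)
(* and boundedness.                                                            *)
Definition bounded_L2_operator
    (S : ('rV[R]_n -> R[i]) -> ('rV[R]_n -> R[i])) : Prop :=
  [/\ forall f, L2 f -> L2 (S f),
      forall (c : R[i]) f g, L2 f -> L2 g ->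
        {ae mu, forall x, S (fun y => c * f y + g y) x = c * S f x + S g x} &
      exists M : R, forall f, L2 f -> (L2norm (S f) <= M%:E * L2norm f)%E].

Definition extends_to_bounded_L2 (T : torus_smooth -> torus_distribution) :
    Prop :=
  exists S, bounded_L2_operator S /\
    forall u : torus_smooth, is_function (T u) (S u).

End torus_calculus.

(* Main.v *)
Require Import Defs.
From HB Require Import structures.
From mathcomp Require Import all_boot all_order all_algebra finmap complex.
From mathcomp Require Import all_classical all_reals all_analysis.
From mathcomp Require Import measurable_realfun zify ring lra.

Set Implicit Arguments.
Unset Strict Implicit.
Unset Printing Implicit Defensive.

Import Order.TTheory GRing.Theory Num.Theory.
Import numFieldNormedType.Exports.
Import complex.

Local Open Scope classical_set_scope.
Local Open Scope ring_scope.
Local Open Scope complex_scope.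

(** With [A_k = exp (i phi_k) a_k], the operator maps [f] to
    [sum_k (F f)(k) A_k], and the whole proof rests on the Gram matrix of the
    [A_k]. Its entries are the integrals of [exp (i (phi_k - phi_l)) a_k a_l^*],
    where the phase has gradient of size [|k - l|] from below (separation) and
    all derivatives of order at most [2n + 1] of size at most [n C |k - l|]
    (telescoping the bound on [diffk] along a lattice path). The gradient of
    [phi_k] is periodic although [phi_k] is not, so [2n] integrations by parts
    are available; they bound the entries by a constant times
    [|k - l|^(-2n) <= 2^n prod_j 1 / (1 + (k_j - l_j)^2)], which is summable.
    Schur's test then gives [|sum_k c_k A_k|^2 <= M sum_k |c_k|^2] for finite
    sums. The same estimate for the plane waves [exp (i k x)] yields, by duality,
    Bessel's inequality for the Fourier coefficients, so the partial sums of the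
    series are Cauchy in [L^2] for every [f] in [L^2]. For smooth [f] the Fourier
    coefficients are absolutely summable, again by non-stationary phase, and the
    pointwise sum agrees almost everywhere with the limit in [L^2] by Fatou's
    lemma. *)

(** * Measurability and integration on the torus *)

(** Everything hinges on constants that do not depend on the pair [k], [l]. The gradient of the
    phase difference is therefore divided by [r = |k - l|]: the quotient obeys upper and lower
    bounds uniform in [k] and [l], hence so does the field used to integrate by parts, and each
    integration gains a factor [1 / r]. One of the [2n + 1] derivatives of the phase is spent on
    forming the gradient, the other [2n] on the integrations; the exponent [2n] is what lets the
    decay split into one factor [1 / (1 + t^2)] per coordinate.

    Two mismatches with the hypotheses shape the preliminaries. The bounds concern derivatives taken
    in one fixed order of the coordinates, whereas iterated divergences produce every order; hence
    the symmetry of mixed derivatives. The bounds hold on the cube only; they reach the whole space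
    by periodicity, which the phase lacks but its gradient has.

    Plane waves are treated as one more oscillating family, so Bessel's inequality comes with a
    constant that need not be sharp. *)

Section rV_measurability.
Context (R : realType) (n : nat).

Let box (c : 'rV[rat]_n) (r : rat) : set 'rV[R]_n :=
  [set y | forall j, `|ratr (c ord0 j) - y ord0 j| < ratr r].

Let measurable_box c r : measurable (box c r).
Proof.
have -> : box c r = \bigcap_(j in [set: 'I_n])
    (@rV_coord R n j @^-1` [set t | `|ratr (c ord0 j) - t| < ratr r]).
  by apply/seteqP; split => y /= h j; [move=> _; exact: h|exact: (h j)].
apply: fin_bigcap_measurable => // j _.
rewrite -[X in measurable X]setTI; apply: measurable_rV_coord => //.
exact: (measurable_ball (ratr (c ord0 j) : R) (ratr r)).
Qed.

(** The sigma-algebra is generated by the coordinates, so an open set has to be written as a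
    countable union of measurable boxes, here those with rational centre and radius. *)
Lemma open_measurable_rV (U : set 'rV[R]_n) : open U -> measurable U.
Proof.
move=> oU.
pose F (p : 'rV[rat]_n * rat) :=
  if `[< box p.1 p.2 `<=` U >] then box p.1 p.2 else set0.
have -> : U = \bigcup_p F p.
  apply/seteqP; split => [y Uy|y [p _]]; last first.
    by rewrite /F; case: asboolP => // pU /pU.
  have /nbhs_ballP[e /= e0 yeU] : nbhs y U by exact: open_nbhs_nbhs.
  (* The centre is within [e / 3] of [y] and the radius lies between [e / 3] and [e / 2]: the box
     contains [y] and stays within [e / 3 + e / 2 < e] of it. *)
  have /choice[c hc] : forall j : 'I_n, exists q : rat,
      `|ratr q - y ord0 j| < e / 3.
    move=> j; have /rat_in_itvoo[q] : y ord0 j < y ord0 j + e / 3 by lra.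
    by rewrite in_itv/= => /andP[? ?]; exists q; rewrite ger0_norm; lra.
  have /rat_in_itvoo[r] : e / 3 < e / 2 by lra.
  rewrite in_itv/= => /andP[r1 r2].
  exists (\row_j c j, r) => //; rewrite /F/=.
  have h : box (\row_j c j) r `<=` U.
    move=> z zb; apply: yeU; split; first exact: e0.
    move=> i j; rewrite !ord1.
    have := zb j; rewrite mxE => zj; have := hc j => cj.
    rewrite /ball/= (_ : _ - _ = (ratr (c j) - z ord0 j) - (ratr (c j) - y ord0 j)); last by ring.
    by rewrite (le_lt_trans (ler_normB _ _))//; lra.
  case: asboolP => // _ j; rewrite mxE; exact: lt_trans (hc j) r1.
apply: countable_bigcupT_measurable; first exact: countableP.
by move=> p; rewrite /F; case: ifP.
Qed.

Lemma continuous_measurable_rV (f : 'rV[R]_n -> R) :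
  continuous f -> measurable_fun setT f.
Proof.
move=> cf.
apply: (measurability _ (RGenOpens.measurableE R)).
move=> _ [_ [a [b ->] <-]]; rewrite setTI.
apply: open_measurable_rV; apply: open_comp => //.
Qed.

End rV_measurability.

Section torus_integral.
Context (R : realType).
Local Notation mu n := (torus_measure R n).

Lemma torus_bounded_integrable n (f : 'rV[R]_n -> R) (M : R) :
  measurable_fun setT f -> (forall x, `|f x| <= M) ->
  (mu n).-integrable setT (EFin \o f).
Proof.
move=> mf fM; apply: measurable_bounded_integrable => //.
  by rewrite ltey_eq fin_num_measure.
exists M; split; first exact: num_real.
by move=> N MN x _ /=; rewrite (le_trans (fM x))// ltW.
Qed.

(** The fundamental theorem of calculus lives on closed intervals, whereas [circle_measure] is a
    restriction to a half-open one; the endpoint is negligible. *)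
Lemma integral_circle (g : measurableTypeR R -> R) (M : R) :
  measurable_fun setT g -> (forall x, `|g x| <= M) ->
  (\int[@circle_measure R]_x (g x)%:E =
   \int[lebesgue_measure]_(x in `[0%R, (2 * pi)%R]) (g x)%:E)%E.
Proof.
move=> mg gM.
rewrite -integral_itv_bndo_bndc; last first.
  by apply/measurable_EFinP; apply: measurable_funTS.
have mD : measurable (`[0, 2 * pi[ : set (measurableTypeR R)).
  exact: measurable_itv.
have ig : (@circle_measure R).-integrable setT (EFin \o g).
  apply: measurable_bounded_integrable => //.
    by rewrite ltey_eq fin_num_measure.
  exists M; split; first exact: num_real.
  by move=> N MN x _ /=; rewrite (le_trans (gM x))// ltW.
have mN0 : @circle_measure R (~` `[0, 2 * pi[) = 0%E.
  by rewrite /circle_measure /mfrestr /mrestr setICl measure0.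
have := negligible_integral (measurableC mD) measurableT ig mN0.
rewrite setTD setCK => ->; apply: eq_measure_integral => A mA AD.
change (lebesgue_measure (A `&` `[0, 2 * pi[) = lebesgue_measure A).
by congr (_ _); apply: setIidl; move: AD.
Qed.

(** Both orders of integration are needed: the coordinate of a partial derivative must be integrated
    innermost, whether it is the first one or one of the others. *)
Lemma integral_torusS n (g : 'rV[R]_n.+1 -> R) (M : R) :
  measurable_fun setT g -> (forall x, `|g x| <= M) ->
  (\int[mu n.+1]_x (g x)%:E =
     \int[@circle_measure R]_t \int[mu n]_y (g (rV_cons (t, y)))%:E)%E /\
  (\int[mu n.+1]_x (g x)%:E =
     \int[mu n]_y \int[@circle_measure R]_t (g (rV_cons (t, y)))%:E)%E.
Proof.
move=> mg gM.
have mc : measurable_fun setT (@rV_cons R n) by exact: measurable_rV_cons.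
have ig : (@circle_measure R \x mu n)%E.-integrable setT
    (EFin \o (g \o @rV_cons R n)).
  apply: measurable_bounded_integrable => //.
  - rewrite -[setT]setXTT /= product_measure1E//.
    by rewrite lte_mul_pinfty// ?fin_num_measure// ltey_eq fin_num_measure.
  - exact: measurableT_comp.
  - exists M; split; first exact: num_real.
    by move=> N MN x _ /=; rewrite (le_trans (gM _))// ltW.
have -> : (\int[mu n.+1]_x (g x)%:E =
    \int[(@circle_measure R \x mu n)%E]_p (g (rV_cons p))%:E)%E.
  rewrite /torus_measure -/(torus_measure R n) /= /rV_prod.
  rewrite (@integral_pushforward _ _ _ _ _ _ mc _ setT (EFin \o g))//.
  exact/measurable_EFinP.
split.
- by rewrite -(integral12_prod_meas1 ig).
- by rewrite -(integral21_prod_meas1 ig).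
Qed.

End torus_integral.

(** * Integrals of derivatives of periodic functions *)

Section integral_of_partial.
Context (R : realType).
Local Notation mu n := (torus_measure R n).

(** A directional derivative is a limit of difference quotients, hence depends only on the
    restriction to a line. This passes derivatives between a function and its slices, even across
    different spaces. *)
Lemma is_derive_slice (V W : normedModType R) (f : V -> R) (F : W -> R)
    (x v : V) (y w : W) (d : R) :
  (forall h : R, F (h *: w + y) = f (h *: v + x)) ->
  is_derive x v f d -> is_derive y w F d.
Proof.
move=> Ff [df dfE].
have E : (fun h : R => h^-1 *: ((F \o shift y) (h *: w) - F y)) =
         (fun h : R => h^-1 *: ((f \o shift x) (h *: v) - f x)).
  apply/funext => h /=; rewrite Ff; congr (_ *: (_ - _)).
  by have := Ff 0; rewrite !scale0r !add0r.
by split; rewrite /derivable /derive E.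
Qed.

Lemma is_derive_line (V : normedModType R) (f g : V -> R) (v : V) :
  (forall x, is_derive x v f (g x)) ->
  forall x (s : R), is_derive s 1 (fun s => f (s *: v + x)) (g (s *: v + x)).
Proof.
move=> df x s; apply: is_derive_slice (df (s *: v + x)) => h.
by rewrite [h *: _]mulr1 scalerDl addrA.
Qed.

Lemma rV_consE0 n (t : R) (y : 'rV[R]_n) :
  rV_cons (t, y) ord0 (ord0 : 'I_n.+1) = t.
Proof.
have -> : (ord0 : 'I_n.+1) = (lshift n (ord0 : 'I_1) : 'I_(1 + n)).
  exact: val_inj.
rewrite /rV_cons.
by apply: (etrans (row_mxEl _ _ _ _)); rewrite mxE.
Qed.

Lemma rV_consES n (t : R) (y : 'rV[R]_n) (i : 'I_n) :
  rV_cons (t, y) ord0 (lift ord0 i) = y ord0 i.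
Proof. by rewrite /rV_cons -rshift1; exact: row_mxEr. Qed.

Lemma unit_vec_shiftE n (s : R) (j i : 'I_n) (x : 'rV[R]_n) :
  (s *: unit_vec R j + x) ord0 i = s * (i == j)%:R + x ord0 i.
Proof. by rewrite !mxE. Qed.

Lemma rV_cons_shift0 n (s t : R) (y : 'rV[R]_n) :
  rV_cons (s + t, y) = s *: unit_vec R ord0 + rV_cons (t, y).
Proof.
apply/rowP => i; rewrite unit_vec_shiftE.
case: (unliftP ord0 i) => [k|] ->.
- by rewrite !rV_consES eq_sym (negbTE (neq_lift _ _)) mulr0 add0r.
- by rewrite !rV_consE0 eqxx mulr1.
Qed.

Lemma rV_cons_shiftS n (j : 'I_n) (s t : R) (y : 'rV[R]_n) :
  rV_cons (t, s *: unit_vec R j + y) =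
  s *: unit_vec R (lift ord0 j) + rV_cons (t, y).
Proof.
apply/rowP => i; rewrite unit_vec_shiftE.
case: (unliftP ord0 i) => [k|] ->.
- by rewrite !rV_consES unit_vec_shiftE (inj_eq lift_inj).
- by rewrite !rV_consE0 (negbTE (neq_lift _ _)) mulr0 add0r.
Qed.

(** Induction on the dimension: a derivative along a later coordinate is handled on slices, one
    along the first coordinate by the fundamental theorem on a period. Continuity of [g] is asked
    only along the direction [j], a form that slices inherit by rewriting. *)
Lemma integral_partial_eq0 n (j : 'I_n) (f g : 'rV[R]_n -> R) (M : R) :
  (forall x, is_derive x (unit_vec R j) f (g x)) ->
  (forall x, continuous (fun s : R => g (s *: unit_vec R j + x))) ->
  measurable_fun setT g -> (forall x, `|g x| <= M) ->
  (forall x, f (x + (2 * pi) *: unit_vec R j) = f x) ->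
  (\int[mu n]_x (g x)%:E = 0)%E.
Proof.
elim: n j f g => [[]//|n IH] j f g df cg mg gM pf.
have [E1 E2] := integral_torusS mg gM.
case: (unliftP ord0 j) => [k|] jE; subst j.
- rewrite E1 integral0_eq// => t _.
  apply: (IH k (fun y => f (rV_cons (t, y)))) => [y|y|||y].
  + by apply: is_derive_slice (df (rV_cons (t, y))) => h; rewrite rV_cons_shiftS.
  + rewrite (_ : (fun s : R => _) =
      (fun s : R => g (s *: unit_vec R (lift ord0 k) + rV_cons (t, y)))).
      exact: cg.
    by apply/funext => s; rewrite rV_cons_shiftS.
  + apply: measurableT_comp => //; apply: measurableT_comp => //.
    exact: measurable_rV_cons.
  + by move=> y; exact: gM.
  + by rewrite addrC rV_cons_shiftS addrC pf.
- rewrite E2 integral0_eq// => y _.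
  have gE : (fun t => g (rV_cons (t, y))) =
      (fun t => g (t *: unit_vec R ord0 + rV_cons (0, y))).
    by apply/funext => t; rewrite -rV_cons_shift0 addr0.
  have fE : (fun t => f (rV_cons (t, y))) =
      (fun t => f (t *: unit_vec R ord0 + rV_cons (0, y))).
    by apply/funext => t; rewrite -rV_cons_shift0 addr0.
  have cgt : continuous (fun t : R => g (rV_cons (t, y))) by rewrite gE; exact: cg.
  have dft (t : R) : is_derive t 1 (fun t => f (rV_cons (t, y))) (g (rV_cons (t, y))).
    by have := is_derive_line df (rV_cons (0, y)) t; rewrite -fE -rV_cons_shift0 addr0.
  have cft : continuous (fun t : R => f (rV_cons (t, y))).
    move=> t; apply: differentiable_continuous; apply: (derivable1_diffP _ _).1.
    by case: (dft t).
  rewrite (@integral_circle _ (fun t => g (rV_cons (t, y))) M)//; last first.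
    exact: (continuous_measurable_fun cgt).
  rewrite (@continuous_FTC2 _ _ (fun t => f (rV_cons (t, y)))).
  + have -> : rV_cons (2 * pi, y) = rV_cons (0, y) + (2 * pi) *: unit_vec R ord0.
      by rewrite addrC -rV_cons_shift0 addr0.
    by rewrite pf subee.
  + by rewrite mulr_gt0// pi_gt0.
  + exact: continuous_subspaceT.
  + split; first by move=> t _; case: (dft t).
    * by apply: cvg_at_right_filter; exact: cft.
    * by apply: cvg_at_left_filter; exact: cft.
  + by move=> t _; rewrite derive1E; case: (dft t).
Qed.

End integral_of_partial.

(** * Symmetry of mixed partial derivatives *)

Section mixed_partials.
Context (R : realType).

Lemma mean_value_line (F dF : R -> R) (h : R) : 0 < h ->
  (forall s : R, is_derive s 1 F (dF s)) ->
  exists2 s, 0 < s < h & F h - F 0 = dF s * h.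
Proof.
move=> h0 dF_.
have cF : {within `[0, h], continuous F}.
  apply: continuous_subspaceT => t; apply: differentiable_continuous.
  by apply: (derivable1_diffP _ _).1; case: (dF_ t).
have [c] := MVT h0 (fun x _ => dF_ x) cF.
by rewrite in_itv/= subr0 => ch E; exists c.
Qed.

(** Mean value theorem twice: along [u] for the increment of [f] in the direction [v], then along
    [v] for [fu]. *)
Lemma mixed_difference (V : normedModType R) (f fu fuv : V -> R) (u v x : V) (h : R) :
  0 < h -> (forall y, is_derive y u f (fu y)) ->
  (forall y, is_derive y v fu (fuv y)) ->
  exists s t, [/\ 0 < s < h, 0 < t < h &
    f (h *: u + (h *: v + x)) - f (h *: u + x) - (f (h *: v + x) - f x) =
    fuv (t *: v + (s *: u + x)) * h * h].
Proof.
move=> h0 df dfu.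
have dF (s : R) : is_derive s 1
    (fun s : R => f (s *: u + (h *: v + x)) - f (s *: u + x))
    (fu (s *: u + (h *: v + x)) - fu (s *: u + x)).
  apply: is_deriveB; exact: (is_derive_line df).
have [s sh Es] := mean_value_line h0 dF.
have [t th Et] := mean_value_line h0 (is_derive_line dfu (s *: u + x)).
exists s, t; split=> //.
rewrite !scale0r !add0r in Es Et; rewrite Es; congr (_ * _); rewrite -Et.
by rewrite addrCA.
Qed.

Lemma continuous_box_rV n (g : 'rV[R]_n -> R) (x : 'rV[R]_n) (e : R) :
  continuous g -> 0 < e -> exists2 d : R, 0 < d &
    forall y : 'rV[R]_n, (forall i, `|x ord0 i - y ord0 i| < d) -> `|g x - g y| < e.
Proof.
move=> cg e0; have /cvgrPdist_lt/(_ _ e0)/nbhs_ballP[d /= d0 h] := cg x.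
exists d => // y xy; apply: h; split => // i j; rewrite !ord1; exact: xy.
Qed.

(** The second difference over a square is symmetric in [i] and [j], so [fij] and [fji] agree at two
    points of any small square at [x]; continuity brings both points to [x]. *)
Lemma mixed_partial_sym n (i j : 'I_n) (f fi fj fij fji : 'rV[R]_n -> R) :
  (forall x, is_derive x (unit_vec R i) f (fi x)) ->
  (forall x, is_derive x (unit_vec R j) f (fj x)) ->
  (forall x, is_derive x (unit_vec R j) fi (fij x)) ->
  (forall x, is_derive x (unit_vec R i) fj (fji x)) ->
  continuous fij -> continuous fji -> fij =1 fji.
Proof.
move=> di dj dij dji cij cji x; apply/eqP; rewrite -subr_eq0 -normr_le0.
rewrite leNgt; apply/negP => e0.
set e := `|_| in e0.
have e20 : 0 < e / 2 by lra.
have [d1 d10 h1] := continuous_box_rV x cij e20.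
have [d2 d20 h2] := continuous_box_rV x cji e20.
pose d := Num.min d1 d2; have d0 : 0 < d by rewrite lt_min d10.
(* Half of [d], because for [i = j] both shifts move the same coordinate. *)
have [h h0 hd] : exists2 h : R, 0 < h & h + h = d by exists (d / 2); lra.
have [s [t [/andP[s0 sh] /andP[t0 th] E1]]] := mixed_difference x h0 di dij.
have [t' [s' [/andP[t'0 t'h] /andP[s'0 s'h] E2]]] := mixed_difference x h0 dj dji.
have E : fij (t *: unit_vec R j + (s *: unit_vec R i + x)) =
         fji (s' *: unit_vec R i + (t' *: unit_vec R j + x)).
  have hh : h * h != 0 by rewrite mulf_neq0 ?gt_eqF.
  apply: (mulIf hh); rewrite !mulrA.
  rewrite -E1 -E2 [h *: unit_vec R i + (h *: _ + x)]addrCA; ring.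
have near (a b : R) (p q : 'I_n) : 0 < a < h -> 0 < b < h -> forall k,
    `|x ord0 k - (a *: unit_vec R p + (b *: unit_vec R q + x)) ord0 k| < d.
  move=> /andP[a0 ah] /andP[b0 bh] k; rewrite !unit_vec_shiftE.
  rewrite (_ : _ - _ = - (a * (k == p)%:R + b * (k == q)%:R)); last by ring.
  rewrite normrN ger0_norm; last by rewrite addr_ge0// mulr_ge0// ?ler0n// ltW.
  by case: (k == p); case: (k == q); rewrite /= ?mulr0 ?mulr1; lra.
have A : `|fij x - fij (t *: unit_vec R j + (s *: unit_vec R i + x))| < e / 2.
  apply: h1 => k; have := near t s j i; rewrite t0 th s0 sh => /(_ isT isT k).
  by move=> /lt_le_trans; apply; rewrite ge_min lexx.
have B : `|fji x - fji (s' *: unit_vec R i + (t' *: unit_vec R j + x))| < e / 2.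
  apply: h2 => k; have := near s' t' i j; rewrite t'0 t'h s'0 s'h => /(_ isT isT k).
  by move=> /lt_le_trans; apply; rewrite ge_min lexx orbT.
rewrite -E in B.
set z := fij (_ + _) in A B.
have : e <= `|fij x - z| + `|fji x - z|.
  rewrite /e (_ : _ - _ = (fij x - z) - (fji x - z)); last by ring.
  exact: ler_normB.
by lra.
Qed.

End mixed_partials.

(** * Iterated derivatives indexed by words *)

Section partial_words.
Context (R : realType) (n : nat).
Implicit Types (f g : 'rV[R]_n -> R) (w : seq 'I_n).

(** Words of directions, the last letter acting first, are suited to induction on the order of
    differentiation; a multi-index is recovered by counting letters. *)
Definition partialw w f : 'rV[R]_n -> R := foldr (@partial R n) f w.

Lemma partialw_rcons w j f : partialw (rcons w j) f = partialw w (partial j f).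
Proof. by rewrite /partialw -cats1 foldr_cat. Qed.

Lemma is_derive_partial j f : (forall x, derivable f x (unit_vec R j)) ->
  forall x, is_derive x (unit_vec R j) f (partial j f x).
Proof. by move=> df x; exact: derivableP. Qed.

Lemma Cdiff_leq m m' f : (m <= m')%N -> Cdiff m' f -> Cdiff m f.
Proof.
elim: m m' f => [|m IH] [|m'] f//=; first by move=> _ [].
by move=> mm' [cf h]; split=> // j; have [df Cf] := h j; split=> //; exact: IH Cf.
Qed.

Lemma Cdiff_partialw m w f : Cdiff (size w + m) f -> Cdiff m (partialw w f).
Proof.
elim/last_ind: w f => [//|w j IH] f; rewrite size_rcons addSn => -[_ /(_ j)[_ C]].
by rewrite partialw_rcons; exact: IH.
Qed.

Lemma partial_sym i j f : Cdiff 2 f -> partial i (partial j f) = partial j (partial i f).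
Proof.
move=> [_ h]; have [di [_ hi]] := h i; have [dj [_ hj]] := h j.
have [dij [cij _]] := hi j; have [dji [cji _]] := hj i.
apply/funext => x; symmetry.
exact: (mixed_partial_sym (is_derive_partial di) (is_derive_partial dj)
  (is_derive_partial dij) (is_derive_partial dji)).
Qed.

Lemma partialw_move m i w1 w2 f : Cdiff m f -> (size (i :: w1 ++ w2) <= m)%N ->
  partialw (i :: w1 ++ w2) f = partialw (w1 ++ i :: w2) f.
Proof.
move=> Cf; elim: w1 => [//|a w1 IH] /= sz.
rewrite partial_sym -/(partialw _ _); last first.
  by apply: Cdiff_partialw; apply: Cdiff_leq Cf; rewrite addn2.
by congr partial; apply: IH; rewrite /= ltnW.
Qed.

Lemma partialw_perm m w w' f : Cdiff m f -> (size w <= m)%N -> perm_eq w w' ->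
  partialw w f = partialw w' f.
Proof.
move=> Cf; elim: w w' => [|i w IH] w' sz.
  by move=> /perm_size/esym/size0nil ->.
move=> pw; have iw' : i \in w' by rewrite -(perm_mem pw) mem_head.
case/splitPr: iw' pw sz => w1 w2 pw sz.
have pw' : perm_eq w (w1 ++ w2).
  by move: pw; rewrite perm_sym perm_catC/= perm_cons perm_catC perm_sym.
rewrite -(partialw_move Cf); last by rewrite /= -(perm_size pw').
by rewrite /= (IH (w1 ++ w2))//; exact: ltnW.
Qed.

Lemma mpartialE (alpha : 'I_n -> nat) f :
  mpartial alpha f = partialw (flatten [seq nseq (alpha j) j | j <- enum 'I_n]) f.
Proof.
rewrite /mpartial /partialw; elim: (enum 'I_n) => [//|j s IH] /=.
rewrite foldr_cat -IH; elim: (alpha j) => [//|k IHk] /=.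
by rewrite IHk.
Qed.

(** [mpartial] differentiates in the order of the coordinates. Since a word may be sorted, bounds on
    [mpartial] give bounds on derivatives taken in any order. *)
Lemma mpartial_count m w f : Cdiff m f -> (size w <= m)%N ->
  mpartial (fun j => count_mem j w) f = partialw w f.
Proof.
move=> Cf sz; rewrite mpartialE; apply/esym/(partialw_perm Cf) => //.
apply/allP => i _; apply/eqP; rewrite count_flatten -map_comp sumnE big_map.
rewrite big_enum/= (bigD1 i)//= count_nseq/= eqxx mul1n big1 ?addn0// => k ki.
by rewrite count_nseq/= (negbTE ki).
Qed.

Lemma msize_count w : msize (fun j : 'I_n => count_mem j w) = size w.
Proof.
rewrite /msize; elim: w => [|i w IH] /=; first by rewrite big1.
by rewrite big_split/= IH (bigD1 i)//= eqxx big1// => k; rewrite eq_sym => /negbTE ->.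
Qed.

End partial_words.

(** * Functions with bounded derivatives *)

Section continuity.
Context (R : realType) (n : nat).
Implicit Types f g : 'rV[R]_n -> R.

Lemma continuous_rVD f g : continuous f -> continuous g ->
  continuous (fun x => f x + g x).
Proof. by move=> cf cg x; exact: (continuousD (cf x) (cg x)). Qed.

Lemma continuous_rVM f g : continuous f -> continuous g ->
  continuous (fun x => f x * g x).
Proof. by move=> cf cg x; exact: (continuousM (cf x) (cg x)). Qed.

Lemma continuous_rVV f : continuous f -> (forall x, f x != 0) ->
  continuous (fun x => (f x)^-1).
Proof. by move=> cf f0 x; exact: (continuousV (f0 x) (cf x)). Qed.

End continuity.

Section bounded_derivatives.
Context (R : realType) (n : nat).
Implicit Types (f g : 'rV[R]_n -> R) (M N : R) (m : nat).
Local Notation e_ j := (unit_vec R j).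

(** One constant bounds all derivatives up to order [m], in every order. The recursion mirrors
    [Cdiff], so that sums, products and inverses follow by induction from the first-order rules. *)
Fixpoint Cbounded m M f : Prop :=
  [/\ continuous f, forall x, `|f x| <= M &
  if m is m'.+1 then
    forall j, (forall x, derivable f x (e_ j)) /\ Cbounded m' M (partial j f)
  else True].

Lemma Cbounded_continuous m M f : Cbounded m M f -> continuous f.
Proof. by case: m => [|m] []. Qed.

Lemma Cbounded_le m M f : Cbounded m M f -> forall x, `|f x| <= M.
Proof. by case: m => [|m] []. Qed.

Lemma Cbounded_ge0 m M f : Cbounded m M f -> 0 <= M.
Proof. by move=> /Cbounded_le/(_ 0); apply: le_trans. Qed.

Lemma Cbounded_weak m M N f : M <= N -> Cbounded m M f -> Cbounded m N f.
Proof.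
move=> MN; elim: m f => [|m IH] f [cf fM h]; split=> //.
- by move=> x; exact: le_trans (fM x) MN.
- by move=> x; exact: le_trans (fM x) MN.
- by move=> j; have [df Cf] := h j; split=> //; exact: IH.
Qed.

Lemma Cbounded_leq m m' M f : (m <= m')%N -> Cbounded m' M f -> Cbounded m M f.
Proof.
elim: m m' f => [|m IH] [|m'] f//=; first by move=> _ [].
by move=> mm' [cf fM h]; split=> // j; have [df Cf] := h j; split=> //; exact: IH Cf.
Qed.

Lemma Cbounded_ext m M f g : f =1 g -> Cbounded m M f -> Cbounded m M g.
Proof. by move=> /funext ->. Qed.

Lemma Cbounded_cst m M (c : R) : `|c| <= M -> Cbounded m M (fun=> c).
Proof.
elim: m c => [|m IH] c cM; first by split=> //; exact: cst_continuous.
split=> //; first exact: cst_continuous.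
move=> j; split; first by move=> x; exact: derivable_cst.
have -> : partial j (fun=> c) = fun=> 0.
  by apply/funext => x; exact: derive_cst.
by apply: IH; rewrite normr0 (le_trans _ cM).
Qed.

Lemma CboundedD m M N f g : Cbounded m M f -> Cbounded m N g ->
  Cbounded m (M + N) (fun x => f x + g x).
Proof.
elim: m f g => [|m IH] f g [cf fM hf] [cg gN hg].
  split=> // [|x]; first exact: continuous_rVD.
  by rewrite (le_trans (ler_normD _ _))// lerD.
split=> [|x|j]; first exact: continuous_rVD.
  by rewrite (le_trans (ler_normD _ _))// lerD.
have [df Cf] := hf j; have [dg Cg] := hg j.
split; first by move=> x; exact: derivableD.
apply: Cbounded_ext (IH _ _ Cf Cg) => x.
by rewrite /partial -deriveD.
Qed.

(** The two terms of Leibniz's rule double the constant at each order. *)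
Lemma CboundedM m M N f g : Cbounded m M f -> Cbounded m N g ->
  Cbounded m (2 ^+ m * M * N) (fun x => f x * g x).
Proof.
elim: m f g => [|m IH] f g [cf fM hf] [cg gN hg].
  rewrite expr0 mul1r; split=> // [|x]; first exact: continuous_rVM.
  by rewrite normrM ler_pM.
have M0 : 0 <= M by exact: le_trans (fM 0).
have N0 : 0 <= N by exact: le_trans (gN 0).
split=> [|x|j]; first exact: continuous_rVM.
  rewrite normrM; apply: (@le_trans _ _ (M * N)); first exact: ler_pM.
  by rewrite -mulrA ler_peMl ?mulr_ge0// exprn_ege1// ler1n.
have [df Cf] := hf j; have [dg Cg] := hg j.
split; first by move=> x; exact: derivableM.
have leq_f : Cbounded m M f by apply: (@Cbounded_leq _ m.+1).
have leq_g : Cbounded m N g by apply: (@Cbounded_leq _ m.+1).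
have := CboundedD (IH _ _ leq_f Cg) (IH _ _ Cf leq_g).
have -> : 2 ^+ m * M * N + 2 ^+ m * M * N = 2 ^+ m.+1 * M * N.
  by rewrite exprS; ring.
apply: Cbounded_ext => x.
rewrite /partial -[in RHS]/(f * g) deriveM//.
by congr (_ + _); exact: mulrC.
Qed.

Lemma CboundedZ m M f (c : R) : Cbounded m M f -> Cbounded m (`|c| * M) (fun x => c * f x).
Proof.
elim: m f => [|m IH] f [cf fM hf].
  split=> // [|x]; first by apply: continuous_rVM => //; exact: cst_continuous.
  by rewrite normrM ler_wpM2l.
split=> [|x|j]; first by apply: continuous_rVM => //; exact: cst_continuous.
  by rewrite normrM ler_wpM2l.
have [df Cf] := hf j.
split.
  by move=> x; exact: derivableZ (df x).
apply: Cbounded_ext (IH _ Cf) => x.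
by rewrite /partial; apply/esym/deriveZ.
Qed.

Lemma CboundedN m M f : Cbounded m M f -> Cbounded m M (fun x => - f x).
Proof.
move=> /(CboundedZ (-1)); rewrite normrN1 mul1r.
by apply: Cbounded_ext => x; rewrite mulN1r.
Qed.

Lemma Cbounded_sum (I : Type) (r : seq I) m (M : I -> R) (f : I -> 'rV[R]_n -> R) :
  (forall i, Cbounded m (M i) (f i)) ->
  Cbounded m (\sum_(i <- r) M i) (fun x => \sum_(i <- r) f i x).
Proof.
move=> h; elim: r => [|i r IH].
  rewrite big_nil; apply: (@Cbounded_ext _ _ (fun=> 0)).
    by move=> x; rewrite big_nil.
  by apply: Cbounded_cst; rewrite normr0.
rewrite big_cons; apply: Cbounded_ext (CboundedD (h i) IH) => x.
by rewrite big_cons.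
Qed.

(** Induction through [(1 / f)' = - (1 / f)^2 f']. The constant is chosen before [f]: this is what
    makes the phase estimates uniform over pairs of lattice points. *)
Lemma CboundedV m M (c : R) : 0 < c -> 0 <= M -> exists N, forall f,
  Cbounded m M f -> (forall x, c <= f x) -> Cbounded m N (fun x => (f x)^-1).
Proof.
move=> c0 M0; elim: m => [|m [N IH]].
  exists c^-1 => f [cf fM _] cf_; have f0 x : f x != 0.
    by rewrite gt_eqF// (lt_le_trans c0).
  split=> // [|x]; first exact: continuous_rVV.
  by rewrite ger0_norm ?invr_ge0 ?(le_trans (ltW c0))// lef_pV2// posrE (lt_le_trans c0).
exists (Num.max c^-1 (2 ^+ m * (2 ^+ m * N * N) * M)) => f Cf cf_.
have f0 x : f x != 0 by rewrite gt_eqF// (lt_le_trans c0).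
have [cf fM hf] := Cf.
split=> [|x|j]; first exact: continuous_rVV.
  rewrite ger0_norm ?invr_ge0 ?(le_trans (ltW c0))// le_max lef_pV2 ?cf_//.
  by rewrite posrE (lt_le_trans c0).
have [df Cdf] := hf j.
split; first by move=> x; exact: derivableV.
apply: (@Cbounded_weak _ (2 ^+ m * (2 ^+ m * N * N) * M)).
  by rewrite le_max lexx orbT.
have /IH/(_ cf_) CV : Cbounded m M f by apply: (@Cbounded_leq _ m.+1).
apply: Cbounded_ext (CboundedN (CboundedM (CboundedM CV CV) Cdf)) => x.
by rewrite /partial deriveV// -mulNr -invfM -expr2; congr (_ * _); rewrite exprVn.
Qed.

Lemma Cbounded_partial m M f j : Cbounded m.+1 M f -> Cbounded m M (partial j f).
Proof. by case=> _ _ /(_ j)[]. Qed.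

Lemma Cdiff_Cbounded m M f : Cdiff m f ->
  (forall w x, (size w <= m)%N -> `|partialw w f x| <= M) -> Cbounded m M f.
Proof.
elim: m f => [|m IH] f.
  by move=> [cf _] h; split=> // x; exact: (h [::] x).
move=> [cf hf] h; split=> // [x|j]; first exact: (h [::] x).
have [df Cf] := hf j; split=> //; apply: IH => // w x sz.
by rewrite -partialw_rcons; apply: h; rewrite size_rcons.
Qed.

End bounded_derivatives.

(** * Periodic functions *)

Section periodicity.
Context (R : realType) (n : nat).
Implicit Types (f g : 'rV[R]_n -> R).
Local Notation e_ j := (unit_vec R j).

Definition rV_periodic f := forall j x, f (x + (2 * pi) *: e_ j) = f x.

Lemma rV_periodic_partial f j : rV_periodic f -> rV_periodic (partial j f).
Proof.
move=> pf i x; rewrite /partial /derive.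
set F := fun h : R => _; set G := fun h : R => _; rewrite (_ : F = G)//.
by apply/funext => h; rewrite /F /G /= addrA !pf.
Qed.

Lemma rV_periodic_int f (j : 'I_n) x (z : int) : rV_periodic f ->
  f (x + (2 * pi * z%:~R) *: e_ j) = f x.
Proof.
move=> pf.
have H (k : nat) y : f (y + (2 * pi * k%:R) *: e_ j) = f y.
  elim: k y => [|k IH] y; first by rewrite mulr0 scale0r addr0.
  by rewrite -[k.+1%:R]natr1 mulrDr mulr1 scalerDl addrA pf IH.
case: z => k; first exact: H.
have := H k.+1 (x - (2 * pi * k.+1%:R) *: e_ j).
by rewrite subrK NegzE mulrNz mulrN scaleNr => ->.
Qed.

(** Extends to the whole space the bounds that are assumed on the cube only. *)
Lemma rV_periodic_cube x : exists2 y, cube y & forall f, rV_periodic f -> f x = f y.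
Proof.
pose z (j : 'I_n) : int := - Num.floor (x ord0 j / (2 * pi)).
exists (x + \sum_j (2 * pi * (z j)%:~R) *: e_ j).
  move=> j; rewrite mxE summxE (bigD1 j)//= big1 ?addr0; last first.
    by move=> i ij; rewrite !mxE eqxx eq_sym (negbTE ij) mulr0.
  rewrite !mxE !eqxx mulr1 /z mulrNz.
  have p0 : 0 < 2 * pi :> R by rewrite mulr_gt0// pi_gt0.
  have := Num.Theory.floor_itv (x ord0 j / (2 * pi)) => /andP[].
  rewrite ler_pdivlMr// intrD ltr_pdivrMr// => h1 h2.
  by apply/andP; split; lra.
move=> f pf; elim: (index_enum _) => [|j s IH]; first by rewrite big_nil addr0.
by rewrite big_cons addrA addrAC rV_periodic_int.
Qed.

Lemma periodic_bounded f : continuous f -> rV_periodic f ->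
  exists M, forall x, `|f x| <= M.
Proof.
move=> cf pf.
pose A := [set y : 'rV[R]_n | forall i, `[0, 2 * pi]%classic (y ord0 i)].
have cA : compact A.
  by apply: (@rV_compact _ _ (fun=> `[0, 2 * pi]%classic)) => _; exact: segment_compact.
have A0 : A !=set0.
  by exists 0 => i /=; rewrite mxE in_itv/= lexx mulr_ge0// pi_ge0.
have cnf : {within A, continuous (fun x => `|f x|)}.
  by apply: continuous_subspaceT => x; exact: (continuous_comp (cf x) (@norm_continuous _ R _)).
have [c _ hc] := EVT_max_rV A0 cA cnf.
exists `|f c| => x; have [y yc ->//] := rV_periodic_cube x.
apply: hc; rewrite inE => i /=; rewrite in_itv/=.
by have /andP[-> /ltW ->] := yc i.
Qed.

Lemma Cdiff_periodic_Cbounded m f : Cdiff m f -> rV_periodic f ->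
  exists M, Cbounded m M f.
Proof.
elim: m f => [|m IH] f [cf hf] pf; have [M hM] := periodic_bounded cf pf.
  by exists M.
have /choice[N hN] : forall j, exists N, Cbounded m N (partial j f).
  by move=> j; have [_ Cf] := hf j; apply: IH => //; exact: rV_periodic_partial.
have N0 j : 0 <= N j by exact: Cbounded_ge0 (hN j).
have M0 : 0 <= M by exact: le_trans (hM 0).
exists (M + \sum_j N j); split=> // [x|j].
  by rewrite (le_trans (hM x))// lerDl sumr_ge0.
have [df _] := hf j; split=> //; apply: Cbounded_weak (hN j).
by rewrite (bigD1 j)//= addrCA lerDl addr_ge0// sumr_ge0.
Qed.

End periodicity.

(** * Real integrals over the torus *)

Section real_integrals.
Context (R : realType) (n : nat).
Local Notation mu := (torus_measure R n).

Lemma integrableT_add (f g : 'rV[R]_n -> R) :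
  mu.-integrable setT (EFin \o f) -> mu.-integrable setT (EFin \o g) ->
  mu.-integrable setT (EFin \o (fun x => f x + g x)).
Proof. by move=> hf hg; have := integrableD measurableT hf hg. Qed.

Lemma integrableT_scale (c : R) (f : 'rV[R]_n -> R) :
  mu.-integrable setT (EFin \o f) ->
  mu.-integrable setT (EFin \o (fun x => c * f x)).
Proof. by move=> hf; have := integrableZl measurableT c hf. Qed.

Lemma integrableT_sum (I : Type) (r : seq I) (f : I -> 'rV[R]_n -> R) :
  (forall i, mu.-integrable setT (EFin \o f i)) ->
  mu.-integrable setT (EFin \o (fun x => \sum_(i <- r) f i x)).
Proof.
move=> h; elim: r => [|i r IH].
  rewrite (_ : (EFin \o _) = cst 0%E); first exact: integrable0.
  by apply/funext => x /=; rewrite big_nil.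
rewrite (_ : (EFin \o _) = EFin \o (fun x => f i x + \sum_(i <- r) f i x)).
  exact: integrableT_add.
by apply/funext => x /=; rewrite big_cons.
Qed.

Lemma RintegralT_sum (I : Type) (r : seq I) (f : I -> 'rV[R]_n -> R) :
  (forall i, mu.-integrable setT (EFin \o f i)) ->
  \int[mu]_x (\sum_(i <- r) f i x) = \sum_(i <- r) \int[mu]_x f i x.
Proof.
move=> h; elim: r => [|i r IH].
  rewrite big_nil (@eq_Rintegral _ _ _ _ _ (fun=> 0)) ?Rintegral_cst ?mul0r//.
  by move=> x _; rewrite big_nil.
rewrite big_cons -IH -RintegralD//; last exact: integrableT_sum.
by apply: eq_Rintegral => x _; rewrite big_cons.
Qed.

Lemma le_Rintegral_torus (f : 'rV[R]_n -> R) (M : R) :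
  measurable_fun setT f -> (forall x, `|f x| <= M) ->
  `|\int[mu]_x f x| <= M * fine (mu setT).
Proof.
move=> mf fM; have intf := torus_bounded_integrable mf fM.
apply: le_trans (le_normr_Rintegral _ _) _ => //.
rewrite -(Rintegral_cst mu measurableT M); apply: le_Rintegral => //.
- exact: integrable_norm.
- exact: finite_measure_integrable_cst.
Qed.

Lemma Rintegral_partial_eq0 (j : 'I_n) (f g : 'rV[R]_n -> R) (M : R) :
  (forall x, is_derive x (unit_vec R j) f (g x)) -> continuous g ->
  (forall x, `|g x| <= M) -> rV_periodic f -> \int[mu]_x g x = 0.
Proof.
move=> df cg gM pf; rewrite /Rintegral (integral_partial_eq0 (M := M) df)//.
- move=> x s; apply: (@continuous_comp _ _ _ (fun s : R => s *: unit_vec R j + x) g).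
    apply: cvgD; last exact: cvg_cst.
    exact: scalel_continuous.
  exact: cg.
- exact: continuous_measurable_rV.
Qed.

Lemma is_derive_comp1 (V : normedModType R) (F : R -> R) (f : V -> R) (x v : V) (a d : R) :
  is_derive (f x) 1 F a -> is_derive x v f d ->
  is_derive x v (fun y => F (f y)) (a * d).
Proof.
move=> dF df.
have df1 : is_derive (0 : R) 1 (fun h : R => f (h *: v + x)) d.
  apply: is_derive_slice df => h.
  by rewrite [h *: 1]mulr1 addr0.
have dF0 : is_derive (f ((0 : R) *: v + x)) 1 F a by rewrite scale0r add0r.
have := @is_derive1_comp _ _ _ _ _ _ dF0 df1.
apply: is_derive_slice => h.
by rewrite /= [h *: 1]mulr1 addr0.
Qed.

End real_integrals.

(** * Non-stationary phase *)

Section nonstationary_phase.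
Context (R : realType) (n : nat).
Local Notation mu := (torus_measure R n).
Local Notation e_ j := (unit_vec R j).
Implicit Types (f psi : 'rV[R]_n -> R) (q dpsi : 'I_n -> 'rV[R]_n -> R).

(** The divergence of the vector field [f q]; up to sign, the formal transpose of the derivation
    [q . grad]. *)
Definition transport q f : 'rV[R]_n -> R :=
  fun x => \sum_j partial j (fun y => q j y * f y) x.

Lemma Cbounded_transport m (Q F : R) q f :
  (forall j, Cbounded m.+1 Q (q j)) -> Cbounded m.+1 F f ->
  Cbounded m (n%:R * 2 ^+ m.+1 * Q * F) (transport q f).
Proof.
move=> hq hf.
have h j := Cbounded_partial j (CboundedM (hq j) hf).
have := Cbounded_sum (index_enum 'I_n) h.
by rewrite sumr_const card_ord -[X in Cbounded _ X]mulr_natl !mulrA.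
Qed.

Lemma rV_periodic_transport q f :
  (forall j, rV_periodic (q j)) -> rV_periodic f -> rV_periodic (transport q f).
Proof.
move=> pq pf i x; apply: eq_bigr => j _.
apply: (rV_periodic_partial (f := fun y => q j y * f y)) => k y.
by rewrite pq pf.
Qed.

(* With [trig' = dtrig], the divergence theorem for the vector field           *)
(* [trig(psi) f q] moves a factor [r = q . grad psi] from one integral to      *)
(* the other.                                                                  *)
Lemma integration_by_parts (trig dtrig : R -> R) (r D F Q : R) psi dpsi q f :
  (forall t : R, is_derive t 1 trig (dtrig t)) ->
  continuous trig -> continuous dtrig ->
  (forall t, `|trig t| <= 1) -> (forall t, `|dtrig t| <= 1) ->
  continuous psi -> (forall j x, is_derive x (e_ j) psi (dpsi j x)) ->
  (forall j, continuous (dpsi j)) -> (forall j x, `|dpsi j x| <= D) ->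
  rV_periodic (fun x => trig (psi x)) ->
  (forall j, Cbounded 1 Q (q j)) -> (forall j, rV_periodic (q j)) ->
  (forall x, \sum_j q j x * dpsi j x = r) ->
  Cbounded 1 F f -> rV_periodic f ->
  r * \int[mu]_x (dtrig (psi x) * f x) =
  - \int[mu]_x (trig (psi x) * transport q f x).
Proof.
move=> dt ct cdt bt bdt cpsi dpsiE cdpsi bdpsi ptpsi Cq pq qr Cf pf.
pose qf j x := q j x * f x.
have Cqf j : Cbounded 1 (2 ^+ 1 * Q * F) (qf j) by exact: CboundedM.
pose g j x := dtrig (psi x) * dpsi j x * qf j x + trig (psi x) * partial j (qf j) x.
have D0 (j : 'I_n) : 0 <= D by exact: le_trans (bdpsi j 0).
have ctpsi : continuous (fun x => trig (psi x)).
  by move=> x; apply: (continuous_comp (cpsi x)); exact: ct.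
have cdtpsi : continuous (fun x => dtrig (psi x)).
  by move=> x; apply: (continuous_comp (cpsi x)); exact: cdt.
have Cp j : Cbounded 0 (2 ^+ 1 * Q * F) (partial j (qf j)) by exact: Cbounded_partial.
have cg j : continuous (g j).
  apply: continuous_rVD; apply: continuous_rVM => //.
  - exact: continuous_rVM.
  - exact: Cbounded_continuous (Cqf j).
  - exact: Cbounded_continuous (Cp j).
have gM j x : `|g j x| <= D * (2 ^+ 1 * Q * F) + 2 ^+ 1 * Q * F.
  apply: le_trans (ler_normD _ _) _; apply: lerD.
    rewrite normrM; apply: ler_pM => //; last exact: Cbounded_le (Cqf j) x.
    by rewrite normrM -[D]mul1r; apply: ler_pM.
  rewrite normrM -[leRHS]mul1r; apply: ler_pM => //.
  exact: Cbounded_le (Cp j) x.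
have g0 j : \int[mu]_x g j x = 0.
  apply: (@Rintegral_partial_eq0 _ _ j (fun x => trig (psi x) * qf j x)) => //.
  - move=> x.
    have d1 : is_derive x (e_ j) (fun x => trig (psi x)) (dtrig (psi x) * dpsi j x).
      exact: is_derive_comp1.
    have d2 : is_derive x (e_ j) (qf j) (partial j (qf j) x).
      by apply: derivableP; have [_ _ /(_ j)[]] := Cqf j.
    have := is_deriveM d1 d2; rewrite /g.
    rewrite [trig _ *: _]/(trig _ * _) [qf _ _ *: _]/(_ * _) [_ + qf _ _ * _]addrC.
    by rewrite [qf j x * _]mulrC.
  - by move=> i x; rewrite ptpsi /qf pq pf.
have ig j : mu.-integrable setT (EFin \o g j).
  apply: torus_bounded_integrable (gM j); exact: continuous_measurable_rV.
have : \int[mu]_x (\sum_j g j x) = 0 by rewrite RintegralT_sum// big1.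
have -> : \int[mu]_x (\sum_j g j x) =
    \int[mu]_x (r * (dtrig (psi x) * f x) + trig (psi x) * transport q f x).
  apply: eq_Rintegral => x _; rewrite /g big_split/= -mulr_sumr; congr (_ + _).
  rewrite -(qr x) mulr_suml; apply: eq_bigr => j _; rewrite /qf; ring.
have Ctr : Cbounded 0 (n%:R * 2 ^+ 1 * Q * F) (transport q f).
  exact: Cbounded_transport.
have i1 : mu.-integrable setT (EFin \o (fun x => dtrig (psi x) * f x)).
  apply: (@torus_bounded_integrable _ _ _ F).
    apply: continuous_measurable_rV; apply: continuous_rVM => //.
    exact: Cbounded_continuous Cf.
  move=> x; rewrite normrM -[F]mul1r; apply: ler_pM => //.
  exact: Cbounded_le Cf x.
have i2 : mu.-integrable setT (EFin \o (fun x => trig (psi x) * transport q f x)).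
  apply: (@torus_bounded_integrable _ _ _ (n%:R * 2 ^+ 1 * Q * F)).
    apply: continuous_measurable_rV; apply: continuous_rVM => //.
    exact: Cbounded_continuous Ctr.
  move=> x; rewrite normrM -[leRHS]mul1r; apply: ler_pM => //.
  exact: Cbounded_le Ctr x.
rewrite RintegralD//; last exact: integrableT_scale.
by rewrite RintegralZl// => /eqP; rewrite addr_eq0 => /eqP.
Qed.

(** Each integration by parts gains [1 / r], costs one derivative of [q] and [f], and exchanges
    cosine and sine; hence the two integrals are estimated together. The bound [D] serves
    integrability only and stays out of the estimate, so [B] depends on [m], [n] and [Q] alone. *)
Lemma nonstationary_phase_transport m (Q : R) : 0 <= Q ->
  exists2 B : R, 0 <= B & forall (r D F : R) psi dpsi q f, 0 < r ->
  continuous psi -> (forall j x, is_derive x (e_ j) psi (dpsi j x)) ->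
  (forall j, continuous (dpsi j)) -> (forall j x, `|dpsi j x| <= D) ->
  rV_periodic (fun x => cos (psi x)) -> rV_periodic (fun x => sin (psi x)) ->
  (forall j, Cbounded m Q (q j)) -> (forall j, rV_periodic (q j)) ->
  (forall x, \sum_j q j x * dpsi j x = r) ->
  Cbounded m F f -> rV_periodic f ->
  `|\int[mu]_x (cos (psi x) * f x)| <= B * F / r ^+ m /\
  `|\int[mu]_x (sin (psi x) * f x)| <= B * F / r ^+ m.
Proof.
move=> Q0; elim: m => [|m [B B0 IH]].
  exists (fine (mu setT)); first exact: fine_ge0.
  move=> r D F psi dpsi q f r0 cpsi _ _ _ _ _ _ _ _ Cf _.
  rewrite expr0 divr1 [_ * F]mulrC; split; apply: le_Rintegral_torus.
  - apply: continuous_measurable_rV; apply: continuous_rVM.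
      by move=> x; apply: (continuous_comp (cpsi x)); exact: continuous_cos.
    exact: Cbounded_continuous Cf.
  - move=> x; rewrite normrM -[F]mul1r; apply: ler_pM => //.
      by rewrite ler_norml cos_geN1 cos_le1.
    exact: Cbounded_le Cf x.
  - apply: continuous_measurable_rV; apply: continuous_rVM.
      by move=> x; apply: (continuous_comp (cpsi x)); exact: continuous_sin.
    exact: Cbounded_continuous Cf.
  - move=> x; rewrite normrM -[F]mul1r; apply: ler_pM => //.
      by rewrite ler_norml sin_geN1 sin_le1.
    exact: Cbounded_le Cf x.
exists (B * (n%:R * 2 ^+ m.+1 * Q)).
  by rewrite !mulr_ge0// exprn_ge0.
move=> r D F psi dpsi q f r0 cpsi dpsiE cdpsi bdpsi pc ps Cq pq qr Cf pf.
have nc (t : R) : `|cos t| <= 1 by rewrite ler_norml cos_geN1 cos_le1.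
have ns (t : R) : `|sin t| <= 1 by rewrite ler_norml sin_geN1 sin_le1.
have Cq' j : Cbounded m Q (q j) by apply: Cbounded_leq (Cq j).
have Cq1 j : Cbounded 1 Q (q j) by apply: Cbounded_leq (Cq j).
have Cf1 : Cbounded 1 F f by apply: Cbounded_leq Cf.
have [h1 h2] := IH r D _ psi dpsi q (transport q f) r0 cpsi dpsiE cdpsi bdpsi pc ps
  Cq' pq qr (Cbounded_transport Cq Cf) (rV_periodic_transport pq pf).
have E1 := integration_by_parts (@is_derive_sin R) (@continuous_sin R)
  (@continuous_cos R) ns nc cpsi dpsiE cdpsi bdpsi ps Cq1 pq qr Cf1 pf.
have dc (t : R) : is_derive t 1 cos (- sin t) by exact: is_derive_cos.
have cms : continuous (fun t : R => - sin t).
  by move=> t; apply: cvgN; exact: continuous_sin.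
have nms (t : R) : `|- sin t| <= 1 by rewrite normrN.
have E2 := integration_by_parts dc (@continuous_cos R) cms nc nms
  cpsi dpsiE cdpsi bdpsi pc Cq1 pq qr Cf1 pf.
have step (X Y : R) : r * X = - Y -> `|Y| <= B * (n%:R * 2 ^+ m.+1 * Q * F) / r ^+ m ->
    `|X| <= B * (n%:R * 2 ^+ m.+1 * Q) * F / r ^+ m.+1.
  move=> XY hY; have -> : X = - Y / r by rewrite -XY mulrC mulKf// gt_eqF.
  rewrite normrM normrN normfV (gtr0_norm r0) ler_pdivrMr//.
  rewrite [r ^+ m.+1]exprS (_ : _ * r = B * (n%:R * 2 ^+ m.+1 * Q * F) / r ^+ m)//.
  by field; rewrite gt_eqF ?exprn_gt0// gt_eqF.
split; first exact: step E1 h2.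
rewrite -normrN; apply: step h1; rewrite -E2; congr (_ * _).
rewrite -mulN1r -RintegralZl//.
  by apply: eq_Rintegral => x _; rewrite mulN1r mulNr.
apply: (@torus_bounded_integrable _ _ _ F).
  apply: continuous_measurable_rV; apply: continuous_rVM; last exact: Cbounded_continuous Cf.
  by move=> x; apply: (continuous_comp (cpsi x)); exact: continuous_sin.
move=> x; rewrite normrM -[F]mul1r; apply: ler_pM => //.
exact: Cbounded_le Cf x.
Qed.

(** The field [q = p / |p|^2] satisfies [q . grad psi = r], and its derivatives are controlled by
    [P] and [c] alone. Here [p] is the gradient of the phase divided by its size [r]. *)
Lemma nonstationary_phase m (P c : R) : 0 <= P -> 0 < c ->
  exists2 B : R, 0 <= B & forall (r F : R) psi p f, 0 < r ->
  continuous psi -> (forall j x, is_derive x (e_ j) psi (r * p j x)) ->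
  rV_periodic (fun x => cos (psi x)) -> rV_periodic (fun x => sin (psi x)) ->
  (forall j, Cbounded m P (p j)) -> (forall j, rV_periodic (p j)) ->
  (forall x, c <= \sum_j p j x ^+ 2) ->
  Cbounded m F f -> rV_periodic f ->
  `|\int[mu]_x (cos (psi x) * f x)| <= B * F / r ^+ m /\
  `|\int[mu]_x (sin (psi x) * f x)| <= B * F / r ^+ m.
Proof.
move=> P0 c0.
pose S := \sum_(j < n) (2 ^+ m * P * P).
have S0 : 0 <= S by apply: sumr_ge0 => j _; rewrite !mulr_ge0// exprn_ge0.
have [V hV] := @CboundedV R n m _ _ c0 S0.
(* The statement of [CboundedV] gives no sign for [V]; the maximum ensures [0 <= Q]. *)
pose Q := 2 ^+ m * P * Num.max 0 V.
have Q0 : 0 <= Q by rewrite !mulr_ge0// ?exprn_ge0// le_max lexx.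
have [B B0 hB] := nonstationary_phase_transport m Q0.
exists B => // r F psi p f r0 cpsi dpsi pc ps Cp pp cp Cf pf.
have Csum : Cbounded m S (fun x => \sum_j p j x ^+ 2).
  exact: Cbounded_sum (fun j => CboundedM (Cp j) (Cp j)).
have CV : Cbounded m (Num.max 0 V) (fun x => (\sum_j p j x ^+ 2)^-1).
  by apply: Cbounded_weak (hV _ Csum cp); rewrite le_max lexx orbT.
apply: (hB r (r * P) F psi (fun j x => r * p j x)
  (fun j x => p j x * (\sum_j p j x ^+ 2)^-1) f) => //.
- move=> j; apply: continuous_rVM; first exact: cst_continuous.
  exact: Cbounded_continuous (Cp j).
- move=> j x; rewrite normrM gtr0_norm// ler_pM2l//; exact: Cbounded_le (Cp j) x.
- by move=> j; exact: CboundedM.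
- move=> j i x; rewrite pp; congr (_ * _^-1).
  by apply: eq_bigr => k _; rewrite pp.
- move=> x; have nz : \sum_j p j x ^+ 2 != 0 by rewrite gt_eqF// (lt_le_trans c0).
  rewrite (eq_bigr (fun j => r / (\sum_j p j x ^+ 2) * p j x ^+ 2)).
    by rewrite -mulr_sumr divfK.
  by move=> j _; rewrite expr2; ring.
Qed.

End nonstationary_phase.

(** * Sums over the lattice *)

Section lattice.
Context (R : realType) (n : nat).
Implicit Types (k l : 'rV[int]_n) (K : {fset 'rV[int]_n}).

Definition lattice_weight k : R := \prod_j (1 + (k ord0 j)%:~R ^+ 2)^-1.

Lemma lattice_weight_ge0 k : 0 <= lattice_weight k.
Proof. by apply: prodr_ge0 => j _; rewrite invr_ge0 addr_ge0// sqr_ge0. Qed.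

Lemma lattice_weight0 : lattice_weight 0 = 1.
Proof. by rewrite /lattice_weight big1// => j _; rewrite mxE expr0n/= addr0 invr1. Qed.

Lemma lattice_weightN k : lattice_weight (- k) = lattice_weight k.
Proof. by apply: eq_bigr => j _; rewrite mxE mulrNz sqrrN. Qed.

Lemma enorm_latticeE k : enorm (latticeR R k) ^+ 2 = \sum_j (k ord0 j)%:~R ^+ 2.
Proof.
rewrite /enorm sqr_sqrtr; last by apply: sumr_ge0 => j _; exact: sqr_ge0.
by apply: eq_bigr => j _; rewrite mxE.
Qed.

Lemma enorm_ge0 (x : 'rV[R]_n) : 0 <= enorm x.
Proof. exact: sqrtr_ge0. Qed.

Lemma ler_coord_enorm k j : `|(k ord0 j)%:~R| <= enorm (latticeR R k).
Proof.
rewrite -ler_sqr ?nnegrE ?enorm_ge0// real_normK ?num_real// enorm_latticeE.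
by rewrite (bigD1 j)//= lerDl sumr_ge0// => i _; exact: sqr_ge0.
Qed.

Lemma enorm_lattice_ge1 k : k != 0 -> 1 <= enorm (latticeR R k).
Proof.
move=> k0; have [j kj] : exists j, k ord0 j != 0.
  apply/existsP; apply: contraNT k0; rewrite negb_exists => /forallP h.
  by apply/eqP/rowP => j; have := h j; rewrite negbK mxE => /eqP.
apply: le_trans (ler_coord_enorm k j).
rewrite -intr_norm -[1]/(1%:~R) ler_int; lia.
Qed.

(** A nonzero lattice point has [|k| >= 1], so each of the [n] factors satisfies
    [1 + k_j^2 <= 2 |k|^2]. *)
Lemma enorm_lattice_weight k : k != 0 ->
  (enorm (latticeR R k) ^+ (2 * n))^-1 <= 2 ^+ n * lattice_weight k.
Proof.
move=> k0; rewrite exprM enorm_latticeE.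
have s1 : 1 <= \sum_j (k ord0 j)%:~R ^+ 2 :> R.
  by rewrite -enorm_latticeE expr_ge1// ?enorm_ge0// enorm_lattice_ge1.
set s := \sum_j _ in s1 *.
rewrite -exprVn -[X in _ ^+ X](card_ord n) -prodr_const -[X in 2 ^+ X](card_ord n).
rewrite -prodr_const -big_split/=; apply: ler_prod => j _.
rewrite invr_ge0 (le_trans ler01 s1)/=.
have ks : (k ord0 j)%:~R ^+ 2 <= s.
  by rewrite /s (bigD1 j)//= lerDl sumr_ge0// => i _; exact: sqr_ge0.
have := sqr_ge0 ((k ord0 j)%:~R : R) => k20.
rewrite ler_pdivlMr; last by lra.
by rewrite mulrC ler_pdivrMr; lra.
Qed.

(** A telescoping majorant: its increments over unit steps dominate [1 / (1 + z^2)], while its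
    values stay in [[-4, 4]]. Hence the bound 8 for the sum over any interval of integers, wherever
    it is placed. *)
Let h (t : R) : R := 4 * t / (1 + `|t|).

Let h_le4 t : `|h t| <= 4.
Proof.
rewrite /h !normrM normfV (ger0_norm (_ : 0 <= 1 + `|t|)); last by rewrite addr_ge0.
by rewrite ler_pdivrMr ?ltr_pwDl// normr_nat ler_pM2l// lerDr.
Qed.

(** The second bound serves the negative integers, which the reflection [t |-> - (t + 1)] sends to
    the nonnegative ones. *)
Let h_step_ge0 (t : R) : 0 <= t ->
  (1 + t ^+ 2)^-1 <= 4 / ((1 + t) * (2 + t)) /\
  (1 + (t + 1) ^+ 2)^-1 <= 4 / ((1 + t) * (2 + t)).
Proof.
move=> t0; have p0 : 0 < (1 + t) * (2 + t) by rewrite mulr_gt0//; lra.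
split; rewrite -div1r ler_pdivrMr 1?mulrAC 1?ler_pdivlMr//; first last.
- by rewrite ltr_pwDl// sqr_ge0.
- by have := sqr_ge0 t; rewrite !expr2; nra.
- by rewrite ltr_pwDl// sqr_ge0.
- by have := sqr_ge0 (t - 1); rewrite !expr2; nra.
Qed.

Let h_step (z : int) : (1 + z%:~R ^+ 2)^-1 <= h (z%:~R + 1) - h z%:~R.
Proof.
have [z0|z0] := lerP 0 z.
  have : 0 <= z%:~R :> R by rewrite ler0z.
  move: (z%:~R : R) => t t0.
  have t1 : 0 <= t + 1 by lra.
  rewrite /h (ger0_norm t0) (ger0_norm t1).
  rewrite (_ : _ - _ = 4 / ((1 + t) * (2 + t))); last first.
    by field; apply/andP; split; apply: lt0r_neq0; lra.
  by have [] := h_step_ge0 t0.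
have u0 : 0 <= - (z%:~R + 1) :> R.
  by rewrite -[1]/(1%:~R) -intrD -mulrNz ler0z; lia.
move: u0; move: (z%:~R : R) => t u0.
have t0 : t <= 0 by lra.
have t1 : t + 1 <= 0 by lra.
rewrite /h (ler0_norm t0) (ler0_norm t1).
rewrite (_ : _ - _ = 4 / ((1 + - (t + 1)) * (2 + - (t + 1)))); last first.
  by field; apply/andP; split; apply: lt0r_neq0; lra.
have [_] := h_step_ge0 u0.
by rewrite (_ : - (t + 1) + 1 = - t) ?sqrrN//; ring.
Qed.

Lemma sum_inv_sqr_le8 M (c : int) :
  \sum_(i < M) (1 + ((i : nat)%:Z + c)%:~R ^+ 2)^-1 <= 8 :> R.
Proof.
have H : \sum_(i < M) (1 + ((i : nat)%:Z + c)%:~R ^+ 2)^-1 <=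
    h (M%:Z + c)%:~R - h c%:~R.
  elim: M => [|M IH]; first by rewrite big_ord0 add0r subrr.
  rewrite big_ord_recr/=.
  have := h_step (M%:Z + c).
  rewrite (_ : (M%:Z + c)%:~R + 1 = (M.+1%:Z + c)%:~R :> R); last first.
    by rewrite -addn1 PoszD !intrD; ring.
  by lra.
apply: le_trans H _.
have := h_le4 (M%:Z + c)%:~R; have := h_le4 c%:~R; rewrite !ler_norml; lra.
Qed.

(** The set [K] is enclosed in a box, over which the sum of a product of functions of one coordinate
    factorises into [n] sums, each at most 8. *)
Lemma sum_lattice_weight K l : \sum_(k <- K) lattice_weight (k - l) <= 8 ^+ n.
Proof.
pose N : nat := (\sum_(k <- K) \sum_j `|k ord0 j|)%N.
have KN k j : k \in K -> (`|k ord0 j| <= N)%N.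
  move=> kK; rewrite /N (big_rem k)//= (bigD1 j)//= -addnA; exact: leq_addr.
(* The box of points with coordinates in [[-N, N]] is identified with the finite functions into
   [2N + 1] values, the index set that distributivity requires. *)
pose dec (f : {ffun 'I_n -> 'I_(N.*2.+1)}) : 'rV[int]_n := \row_j ((f j : nat)%:Z - N%:Z).
pose enc k : {ffun 'I_n -> 'I_(N.*2.+1)} := [ffun j => inord (absz (k ord0 j + N%:Z))].
have encK k : k \in K -> dec (enc k) = k.
  move=> kK; apply/rowP => j; have := KN k j kK; rewrite mxE ffunE.
  move: (k ord0 j) => z zN; rewrite inordK; last by lia.
  by lia.
rewrite big_seq (eq_bigr (fun k => lattice_weight (dec (enc k) - l))); last first.
  by move=> k kK; rewrite encK.
rewrite -big_seq.
have -> : \sum_(k <- K) lattice_weight (dec (enc k) - l) =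
    \sum_(f <- map enc K) lattice_weight (dec f - l) by rewrite big_map.
have encu : uniq (map enc K).
  rewrite map_inj_in_uniq ?fset_uniq// => x y xK yK xy.
  by rewrite -(encK x)// xy encK.
rewrite big_uniq//=.
apply: (@le_trans _ _ (\sum_(f : {ffun 'I_n -> 'I_(N.*2.+1)}) lattice_weight (dec f - l))).
  rewrite [leRHS](bigID (fun f => f \in map enc K))/= lerDl sumr_ge0// => f _.
  exact: lattice_weight_ge0.
rewrite /lattice_weight.
under eq_bigr do under eq_bigr do rewrite !mxE -addrA.
rewrite -(bigA_distr_bigA (fun j (i : 'I_(N.*2.+1)) =>
   (1 + ((i : nat)%:Z + (- N%:Z + - l ord0 j))%:~R ^+ 2)^-1 : R)).
rewrite -[X in 8 ^+ X](card_ord n) -prodr_const; apply: ler_prod => j _.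
rewrite sum_inv_sqr_le8 andbT; apply: sumr_ge0 => i _.
by rewrite invr_ge0 addr_ge0// sqr_ge0.
Qed.

(** Induction on the l1 distance, moving [l] by one unit towards [k] in a coordinate where they
    differ. The factor [n] compares the l1 distance with the Euclidean one. *)
Lemma lattice_lipschitz (G : 'rV[int]_n -> R) (C : R) k l :
  (forall k j, `|G (k + delta_mx ord0 j) - G k| <= C) ->
  `|G k - G l| <= C * n%:R * enorm (latticeR R (k - l)).
Proof.
move=> GC.
have H : `|G k - G l| <= C * (\sum_j `|k ord0 j - l ord0 j|)%N%:R.
  have [m] := ubnP (\sum_j `|k ord0 j - l ord0 j|)%N.
  elim: m l => // m IH l lm.
  have [kl|] := eqVneq k l.
    by rewrite kl subrr normr0 big1 ?mulr0// => j _; rewrite subrr.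
  move=> kl; have [j kj] : exists j, k ord0 j != l ord0 j.
    apply/existsP; apply: contraNT kl; rewrite negb_exists => /forallP h0.
    by apply/eqP/rowP => j; have := h0 j; rewrite negbK => /eqP.
  have step (l' : 'rV[int]_n) : `|G l' - G l| <= C ->
      (forall i, i != j -> l' ord0 i = l ord0 i) ->
      `|k ord0 j - l ord0 j|%N = `|k ord0 j - l' ord0 j|.+1 ->
      `|G k - G l| <= C * (\sum_j `|k ord0 j - l ord0 j|)%N%:R.
    move=> ll' li lj.
    have E : (\sum_j `|k ord0 j - l ord0 j| = (\sum_j `|k ord0 j - l' ord0 j|).+1)%N.
      rewrite (bigD1 j)//= lj addSn [in RHS](bigD1 j)//=; congr (_ + _).+1.
      by apply: eq_bigr => i ij; rewrite li.
    have := IH l'; rewrite -ltnS -E => /(_ lm) h1.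
    rewrite E -natr1 mulrDr mulr1 (_ : G k - G l = (G k - G l') + (G l' - G l)).
      by rewrite (le_trans (ler_normD _ _))// lerD.
    by ring.
  have [klj|klj] := ltP (k ord0 j) (l ord0 j).
  - apply: (step (l - delta_mx ord0 j)).
    + by have := GC (l - delta_mx ord0 j) j; rewrite subrK distrC.
    + by move=> i ij; rewrite !mxE eqxx (negbTE ij) subr0.
    + rewrite !mxE !eqxx/=; lia.
  - apply: (step (l + delta_mx ord0 j)); first exact: GC.
    + by move=> i ij; rewrite !mxE eqxx (negbTE ij) addr0.
    + rewrite !mxE !eqxx/=; lia.
(* The sign of [C] can be read off the hypothesis only if there is a coordinate; for [n = 0] both
   sides vanish. *)
apply: le_trans H _; rewrite -mulrA; have [n0|n0] := posnP n.
  rewrite big1 => [|j]; last by have := ltn_ord j; rewrite {2}n0.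
  by rewrite (_ : n%:R = 0) ?mul0r ?mulr0// n0.
have C0 : 0 <= C by exact: le_trans (normr_ge0 _) (GC k (Ordinal n0)).
apply: ler_wpM2l => //; rewrite natr_sum mulr_natl -[X in _ *+ X](card_ord n) -sumr_const.
apply: ler_sum => j _.
have := ler_coord_enorm (k - l) j; apply: le_trans.
by rewrite !mxE -intr_norm natr_absz.
Qed.

(** Increasing finite sets that eventually contain any given finite set. They turn unconditional
    sums over the lattice into limits of sequences, as completeness and Fatou's lemma require. A
    code that decodes to no point contributes the point 0. *)
Definition exhaustion (N : nat) : {fset 'rV[int]_n} :=
  [fset k in [seq odflt 0 (@choice.unpickle 'rV[int]_n i) | i <- iota 0 N]]%fset.

Let in_exhaustion N k : k \in exhaustion N <->
  exists2 i, (i < N)%N & k = odflt 0 (@choice.unpickle 'rV[int]_n i).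
Proof.
rewrite in_fset; split=> [kN|[i iN ->]]; last first.
  by apply: (map_f (fun i => odflt 0 (choice.unpickle i))); rewrite mem_iota.
by move: kN => /mapP[p]; rewrite mem_iota => pN ->; exists p.
Qed.

Lemma exhaustion_sub N M : (N <= M)%N -> fsubset (exhaustion N) (exhaustion M).
Proof.
move=> NM; apply/fsubsetP => k /in_exhaustion[i iN ki]; apply/in_exhaustion.
by exists i => //; exact: leq_trans NM.
Qed.

Lemma exhaustion_exists K : exists N, forall M, (N <= M)%N -> fsubset K (exhaustion M).
Proof.
exists (\sum_(k <- K) (choice.pickle k).+1)%N => M NM; apply/fsubsetP => k kK.
apply/in_exhaustion; exists (choice.pickle k); last by rewrite choice.pickleK.
by apply: leq_trans NM; rewrite (big_rem k)//= leq_addr.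
Qed.

End lattice.

(** * Completeness of the square-integrable functions *)

Section square_integral.
Context d (T : measurableType d) (R : realType).
Variable mu : {finite_measure set T -> \bar R}.
Implicit Types (f g : T -> R) (e : R).

Definition sqint f : \bar R := (\int[mu]_x (f x ^+ 2)%:E)%E.

Let measurable_sqr f : measurable_fun setT f ->
  measurable_fun setT (fun x => (f x ^+ 2)%:E).
Proof. by move=> mf; apply/measurable_EFinP; exact: measurable_funX. Qed.

Let sqr_ge0E f x : (0 <= (f x ^+ 2)%:E)%E.
Proof. by rewrite lee_fin sqr_ge0. Qed.

Lemma sqint_ge0 f : (0 <= sqint f)%E.
Proof. by apply: integral_ge0 => x _; exact: sqr_ge0E. Qed.

(** From [(a + b)^2 <= 2 (a^2 + b^2)]: the factor 2 is the price for working with squared norms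
    instead of Minkowski's inequality. *)
Lemma sqintD f g : measurable_fun setT f -> measurable_fun setT g ->
  (sqint (fun x => (f x + g x)%R) <= 2%:E * (sqint f + sqint g))%E.
Proof.
move=> mf mg; rewrite /sqint -ge0_integralD//; try exact: measurable_sqr.
rewrite -ge0_integralZl//; last 2 first.
- by apply: emeasurable_funD; exact: measurable_sqr.
- by move=> x _; rewrite adde_ge0.
apply: ge0_le_integral => //.
- by move=> x _; rewrite lee_fin sqr_ge0.
- by apply: measurable_sqr; exact: measurable_funD.
- by apply: measurable_funeM; apply: emeasurable_funD; exact: measurable_sqr.
- move=> x _; rewrite -EFinD -EFinM lee_fin.
  have := sqr_ge0 (f x - g x); rewrite !expr2; nra.
Qed.

Lemma sqint_eq0 f : measurable_fun setT f -> sqint f = 0%E ->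
  {ae mu, forall x, f x = 0}.
Proof.
move=> mf f0.
have : (\int[mu]_x `|(f x ^+ 2)%:E| = 0)%E.
  by rewrite -[RHS]f0; apply: eq_integral => x _; rewrite gee0_abs.
move/(ae_eq_integral_abs mu measurableT (measurable_sqr mf)).
by apply: filterS => x /(_ I)[] /eqP; rewrite sqrf_eq0 => /eqP.
Qed.

Lemma sqint_ae f g : measurable_fun setT f -> measurable_fun setT g ->
  {ae mu, forall x, f x = g x} -> sqint f = sqint g.
Proof.
move=> mf mg fg; apply: ge0_ae_eq_integral => //; try exact: measurable_sqr.
by apply: filterS fg => x -> _.
Qed.

Lemma sqint_fatou (f_ : nat -> T -> R) f (e : \bar R) :
  (forall i, measurable_fun setT (f_ i)) ->
  (forall x, (fun i => f_ i x) @ \oo --> f x) ->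
  (exists N, forall i, (N <= i)%N -> (sqint (f_ i) <= e)%E) ->
  (sqint f <= e)%E.
Proof.
move=> mf cf [N hN].
pose u i x := ((f_ (i + N)%N x) ^+ 2)%:E : \bar R.
have cu x : (fun i => u i x) @ \oo --> (f x ^+ 2)%:E.
  have cN : (fun i => f_ (i + N)%N x) @ \oo --> f x 
    by have := cf x; rewrite -(cvg_shiftn N (fun i => f_ i x)).
  by apply: cvg_EFin; [exact: nearW|exact: (cvgM cN cN)].
rewrite /sqint (eq_integral (fun x => limn_einf (u^~ x))); last first.
  by move=> x _; rewrite (cvg_limn_einf_sup (cu x)).1.
apply: le_trans (fatou _ _ _ _) _ => //.
- by move=> i; exact: measurable_sqr.
- by move=> i x _; exact: sqr_ge0E.
rewrite limn_einf_lim; apply: lime_le; first exact: is_cvg_einfs.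
apply: nearW => i; apply: ge_ereal_inf; exists (\int[mu]_x u i x)%E.
  by exists i => /=.
by apply: hN; exact: leq_addl.
Qed.

(** Pointwise [|f| <= a + f^2 / a]. The free parameter [a] balances the two terms, in place of the
    Cauchy-Schwarz inequality. *)
Lemma integral_norm_le_sqint f (a : R) : 0 < a -> measurable_fun setT f ->
  (\int[mu]_x `|f x|%R%:E <= a%:E * mu setT + (a^-1)%R%:E * sqint f)%E.
Proof.
move=> a0 mf.
have ai0 : 0 <= a^-1 by rewrite invr_ge0 ltW.
rewrite /sqint -(integral_cst mu measurableT) -ge0_integralZl//; last exact: measurable_sqr.
rewrite -ge0_integralD//; last 3 first.
- by move=> x _; rewrite lee_fin ltW.
- by move=> x _; rewrite mule_ge0.
- by apply: measurable_funeM; exact: measurable_sqr.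
apply: ge0_le_integral => //.
- by apply/measurable_EFinP; exact: measurableT_comp.
- by apply: emeasurable_funD => //; apply: measurable_funeM; exact: measurable_sqr.
move=> x _; rewrite /cst/= lee_fin -(ler_pM2l a0) mulrDr mulrA mulfV ?gt_eqF// mul1r.
rewrite -[f x ^+ 2]real_normK ?num_real//.
have := sqr_ge0 (`|f x| - a); have := normr_ge0 (f x); rewrite !expr2; nra.
Qed.

(** The sum [D] of the absolute increments is integrable, hence finite almost everywhere. Cutting
    off outside the set [E] where it is finite makes the convergence hold at every point, so that
    the limit is measurable and Fatou's lemma applies directly. *)
Lemma ae_cvg_fast_cauchy (g_ : nat -> T -> R) :
  (forall i, measurable_fun setT (g_ i)) ->
  (forall i, (sqint (fun x => (g_ i.+1 x - g_ i x)%R) <= ((4 ^+ i)^-1)%R%:E)%E) ->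
  exists g, [/\ measurable_fun setT g &
    exists E, [/\ measurable E, {ae mu, forall x, E x} &
      forall x, (fun i => g_ i x * \1_E x) @ \oo --> g x]].
Proof.
move=> mg hg.
pose dd i x := `|g_ i.+1 x - g_ i x|.
have dd0 i x : (0 <= (dd i x)%:E)%E by rewrite lee_fin normr_ge0.
have mdd i : measurable_fun setT (fun x => (dd i x)%:E).
  by apply/measurable_EFinP; apply: measurableT_comp => //; exact: measurable_funB.
pose m := fine (mu setT).
have muE : mu setT = m%:E by rewrite /m fineK// fin_num_measure.
have m0 : 0 <= m by exact: fine_ge0.
have hd i : (\int[mu]_x (dd i x)%:E <= ((m + 1) / (2 ^+ i))%R%:E)%E.
  (* The choice [a = 2^-i] turns the bound [4^-i] on the squares into [(m + 1) / 2^i], which is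
     summable. *)
  have a0 : 0 < (2 ^+ i)^-1 :> R by rewrite invr_gt0 exprn_gt0.
  apply: le_trans (integral_norm_le_sqint a0 _) _; first exact: measurable_funB.
  rewrite muE invrK mulrDl mul1r EFinD -EFinM [m / _]mulrC leeD2l//.
  apply: (@le_trans _ _ ((2 ^+ i)%R%:E * ((4 ^+ i)^-1)%R%:E)%E).
    by apply: lee_wpmul2l; rewrite ?hg// lee_fin exprn_ge0.
  rewrite -EFinM lee_fin (_ : 4 = 2 * 2 :> R); last by rewrite -natrM.
  by rewrite exprMn invfM mulrA mulfV ?mul1r// gt_eqF// exprn_gt0.
pose D x : \bar R := (\sum_(i <oo) (dd i x)%:E)%E.
have mD : measurable_fun setT D.
  apply: ge0_emeasurable_sum => [i x _ _|i _]; [exact: dd0|exact: mdd].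
have D0 x : (0 <= D x)%E by apply: nneseries_ge0 => i _ _; exact: dd0.
have iD : mu.-integrable setT D.
  apply/integrableP; split => //.
  under eq_integral do rewrite gee0_abs//.
  rewrite /D integral_nneseries//.
  apply: (@le_lt_trans _ _ (\sum_(i <oo) ((m + 1) / 2 ^+ i)%R%:E)%E).
    by apply: lee_nneseries => // i _ _; apply: integral_ge0 => x _; exact: dd0.
  rewrite (_ : (fun k => _) = EFin \o series (geometric (m + 1) 2^-1)); last first.
    apply/funext => k /=; rewrite /series/= -sumEFin big_mkord.
    by rewrite big_mkord; apply: eq_bigr => i _; rewrite /geometric/= exprVn.
  rewrite EFin_lim ?ltry//; apply: is_cvg_geometric_series.
  by rewrite ger0_norm// invf_lt1// ltr1n.
pose E := [set x | (D x < +oo)%E].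
have mE : measurable E.
  rewrite -[E]setTI; exact: emeasurable_fun_infty_o.
have aeE : {ae mu, forall x, E x}.
  have := integrable_ae measurableT iD; apply: filterS => x /(_ I).
  by rewrite ge0_fin_numE.
have cg x : E x -> cvgn (fun i => g_ i x).
  move=> Ex.
  have c1 : cvgn [normed series (fun i => g_ i.+1 x - g_ i x)].
    apply: (@nondecreasing_is_cvgn R).
      by apply: nondecreasing_series => i _ _; exact: normr_ge0.
    exists (fine (D x)) => _ [k _ <-].
    rewrite -lee_fin fineK ?ge0_fin_numE// /series/= -sumEFin.
    by apply: (@nneseries_lim_ge R) => i _ _; exact: dd0.
  have c2 := normed_cvg c1.
  have -> : (fun i => g_ i x) =
      (fun i => g_ 0%N x + series (fun i => g_ i.+1 x - g_ i x) i).
    apply/funext => i; rewrite /series/= telescope_sumr//; ring.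
  by apply: is_cvgD => //; exact: is_cvg_cst.
pose h i x := g_ i x * \1_E x.
have mh i : measurable_fun setT (h i).
  by apply: measurable_funM => //; exact: measurable_indic.
have ch x : (fun i => h i x) @ \oo --> limn (fun i => h i x).
  have [Ex|Ex] := pselect (E x).
    apply: is_cvgM; first exact: cg.
    exact: is_cvg_cst.
  apply: (@is_cvg_near_cst _ _ _ _ _) .
  by rewrite /h indicE memNset//; apply: nearW => i; rewrite mulr0.
exists (fun x => limn (fun i => h i x)); split; last by exists E.
by apply: (measurable_fun_cvg mh) => x _; exact: ch.
Qed.

(** A fast subsequence converges almost everywhere; Fatou's lemma along it, with [g_ N] held fixed,
    passes the bound [eps N] to the limit without loss. *)
Lemma sqint_complete (g_ : nat -> T -> R) (eps : nat -> R) :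
  (forall i, measurable_fun setT (g_ i)) ->
  (forall N M, (N <= M)%N -> (sqint (fun x => (g_ M x - g_ N x)%R) <= (eps N)%:E)%E) ->
  (forall e, 0 < e -> exists N, forall m, (N <= m)%N -> eps m <= e) ->
  exists2 g : T -> R, measurable_fun setT g &
    forall N, (sqint (fun x => (g x - g_ N x)%R) <= (eps N)%:E)%E.
Proof.
move=> mg hg heps.
have /choice[s hs] : forall i : nat, exists N, forall m, (N <= m)%N -> eps m <= (4 ^+ i)^-1.
  by move=> i; apply: heps; rewrite invr_gt0 exprn_gt0.
(* Three properties are built in: [t i >= s i] for fast convergence, monotonicity so that
   consecutive terms are comparable, and [t i >= i] so that the subsequence eventually exceeds any
   [N]. *)
pose t := fix t i := if i is i'.+1 then (maxn (t i') (maxn (s i) i)) else s 0%N.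
have ts i : (s i <= t i)%N by case: i => [|i] //=; rewrite !leq_max leqnn orbT.
have tS i : (t i <= t i.+1)%N by rewrite /= leq_max leqnn.
have ti i : (i <= t i)%N by case: i => [|i] //=; rewrite !leq_max leqnn !orbT.
have [g [mg' [E [mE aeE cg]]]] : exists g, [/\ measurable_fun setT g &
    exists E, [/\ measurable E, {ae mu, forall x, E x} &
      forall x, (fun i => g_ (t i) x * \1_E x) @ \oo --> g x]].
  apply: (@ae_cvg_fast_cauchy (fun i => g_ (t i))) => i //.
  by apply: le_trans (hg _ _ (tS i)) _; rewrite lee_fin; exact: hs.
exists g => // N.
apply: (@sqint_fatou (fun i x => g_ (t i) x * \1_E x - g_ N x)).
- by move=> i; apply: measurable_funB => //; apply: measurable_funM.
- by move=> x; apply: cvgB; [exact: cg|exact: cvg_cst].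
- exists N => i Ni; rewrite (@sqint_ae _ (fun x => g_ (t i) x - g_ N x)).
  + by apply: hg; exact: leq_trans (ti i).
  + by apply: measurable_funB => //; apply: measurable_funM.
  + exact: measurable_funB.
  + by apply: filterS aeE => x Ex; rewrite indicE mem_set// mulr1.
Qed.

End square_integral.

(** * Complex-valued functions *)

Section complex_arithmetic.
Context (R : realType).
Implicit Types (z w : R[i]).

Lemma cReD z w : Re (z + w) = Re z + Re w. Proof. by case: z w => ? ? []. Qed.
Lemma cImD z w : Im (z + w) = Im z + Im w. Proof. by case: z w => ? ? []. Qed.
Lemma cReN z : Re (- z) = - Re z. Proof. by case: z. Qed.
Lemma cImN z : Im (- z) = - Im z. Proof. by case: z. Qed.
Lemma cReM z w : Re (z * w) = Re z * Re w - Im z * Im w.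
Proof. by case: z w => ? ? []. Qed.
Lemma cImM z w : Im (z * w) = Re z * Im w + Im z * Re w.
Proof. by case: z w => ? ? []. Qed.

Lemma complex_ReIm_eq z w : Re z = Re w -> Im z = Im w -> z = w.
Proof. by case: z w => ? ? [? ?] /= -> ->. Qed.

Lemma cnormE z : cnorm z = Num.sqrt (Re z ^+ 2 + Im z ^+ 2).
Proof. by case: z. Qed.

Lemma cnorm_sqr z : cnorm z ^+ 2 = Re z ^+ 2 + Im z ^+ 2.
Proof. by rewrite cnormE sqr_sqrtr// addr_ge0// sqr_ge0. Qed.

Lemma cnorm_ge0 z : 0 <= cnorm z.
Proof. by rewrite cnormE sqrtr_ge0. Qed.

Lemma cnorm0 : cnorm (0 : R[i]) = 0.
Proof. exact: ComplexField.Normc.normc0. Qed.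

Lemma cnormM z w : cnorm (z * w) = cnorm z * cnorm w.
Proof. exact: ComplexField.Normc.normcM. Qed.

Lemma cnorm_triangle z w : cnorm (z + w) <= cnorm z + cnorm w.
Proof. exact: le_normcD. Qed.

Lemma cnorm_sum (I : Type) (r : seq I) (F : I -> R[i]) :
  cnorm (\sum_(k <- r) F k) <= \sum_(k <- r) cnorm (F k).
Proof.
elim: r => [|k r IH]; first by rewrite !big_nil cnorm0.
by rewrite !big_cons (le_trans (cnorm_triangle _ _))// lerD2l.
Qed.

Lemma cnorm_conj z : cnorm (conjc z) = cnorm z.
Proof. by rewrite !cnormE; case: z => a b /=; rewrite sqrrN. Qed.

Lemma cnorm_real (t : R) : 0 <= t -> cnorm t%:C = t.
Proof. by move=> t0; rewrite cnormE/= expr0n/= addr0 sqrtr_sqr ger0_norm. Qed.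

Lemma normr_Re z : `|Re z| <= cnorm z.
Proof.
rewrite -ler_sqr ?nnegrE ?cnorm_ge0// real_normK ?num_real// cnorm_sqr.
by rewrite lerDl sqr_ge0.
Qed.

Lemma normr_Im z : `|Im z| <= cnorm z.
Proof.
rewrite -ler_sqr ?nnegrE ?cnorm_ge0// real_normK ?num_real// cnorm_sqr.
by rewrite lerDr sqr_ge0.
Qed.

Lemma cnorm_le_ReIm z : cnorm z <= `|Re z| + `|Im z|.
Proof.
rewrite -ler_sqr ?nnegrE ?cnorm_ge0 ?addr_ge0// cnorm_sqr sqrrD !real_normK ?num_real//.
by rewrite addrAC lerDl mulrn_wge0// mulr_ge0.
Qed.

Lemma mulC_conj z : z * conjc z = (cnorm z ^+ 2)%:C.
Proof. by rewrite cnorm_sqr; apply: complex_ReIm_eq; case: z => a b /=; ring. Qed.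

Lemma cnorm_expi (t : R) : cnorm (expi t) = 1.
Proof. by rewrite cnormE /expi/= cos2Dsin2 sqrtr1. Qed.

Lemma expiD (s t : R) : expi (s + t) = expi s * expi t.
Proof. by apply: complex_ReIm_eq => /=; rewrite ?cosD ?sinD; ring. Qed.

Lemma expiN (t : R) : expi (- t) = conjc (expi t).
Proof. by rewrite /expi cosN sinN. Qed.

End complex_arithmetic.

(** * Square-integrable complex functions *)

Section complex_integral.
Context (R : realType) (n : nat).
Local Notation mu := (torus_measure R n).
Implicit Types (f g h : 'rV[R]_n -> R[i]) (c : R[i]).

Let isum (f g : 'rV[R]_n -> R) a b :
  mu.-integrable setT (EFin \o f) -> mu.-integrable setT (EFin \o g) ->
  mu.-integrable setT (EFin \o (fun x => a * f x + b * g x)) /\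
  \int[mu]_x (a * f x + b * g x) = a * \int[mu]_x f x + b * \int[mu]_x g x.
Proof.
move=> hf hg.
have hf' := integrableT_scale a hf; have hg' := integrableT_scale b hg.
split; first exact: integrableT_add.
by rewrite RintegralD// !RintegralZl.
Qed.

Lemma torus_integrable_lin c f g : torus_integrable f -> torus_integrable g ->
  torus_integrable (fun x => c * f x + g x) /\
  torus_int (fun x => c * f x + g x) = c * torus_int f + torus_int g.
Proof.
move=> [fr fi] [gr gi].
have [i1 e1] := isum (Re c) (- Im c) fr fi.
have [i2 e2] := isum (Re c) (Im c) fi fr.
have [i3 e3] := isum 1 1 i1 gr.
have [i4 e4] := isum 1 1 i2 gi.
have ER : (fun x => 1 * (Re c * Re (f x) + - Im c * Im (f x)) + 1 * Re (g x)) =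
    (fun x => Re (c * f x + g x)).
  by apply/funext => x; rewrite cReD cReM; ring.
have EI : (fun x => 1 * (Re c * Im (f x) + Im c * Re (f x)) + 1 * Im (g x)) =
    (fun x => Im (c * f x + g x)).
  by apply/funext => x; rewrite cImD cImM; ring.
rewrite ER in i3 e3; rewrite EI in i4 e4.
split; first by split.
apply: complex_ReIm_eq; rewrite /torus_int/= ?cReD ?cImD ?cReM ?cImM/=.
- by rewrite e3 e1; ring.
- by rewrite e4 e2; ring.
Qed.

Lemma torus_integrable0 : torus_integrable (fun _ : 'rV[R]_n => 0 : R[i]).
Proof. by split; exact: integrable0. Qed.

Lemma torus_int0 : torus_int (fun _ : 'rV[R]_n => 0 : R[i]) = 0 :> R[i].
Proof. by apply: complex_ReIm_eq; rewrite /torus_int/= Rintegral_cst// mul0r. Qed.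

Lemma torus_int_sum (I : Type) (r : seq I) (c : I -> R[i]) (F : I -> 'rV[R]_n -> R[i]) :
  (forall k, torus_integrable (F k)) ->
  torus_integrable (fun x => \sum_(k <- r) c k * F k x) /\
  torus_int (fun x => \sum_(k <- r) c k * F k x) = \sum_(k <- r) c k * torus_int (F k).
Proof.
move=> hF; elim: r => [|k r [IH1 IH2]].
  have -> : (fun x : 'rV[R]_n => \sum_(k <- [::]) c k * F k x) = fun=> 0.
    by apply/funext => x; rewrite big_nil.
  by rewrite big_nil; split; [exact: torus_integrable0|exact: torus_int0].
have -> : (fun x : 'rV[R]_n => \sum_(k <- k :: r) c k * F k x) =
    fun x => c k * F k x + \sum_(k <- r) c k * F k x.
  by apply/funext => x; rewrite big_cons.
have [h1 h2] := torus_integrable_lin (c k) (hF k) IH1.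
by rewrite big_cons -IH2; split.
Qed.

Lemma torus_int_conj f : torus_integrable f ->
  torus_int (fun x => conjc (f x)) = conjc (torus_int f).
Proof.
move=> [fr fi]; apply: complex_ReIm_eq => /=.
  by apply: eq_Rintegral => x _; case: (f x).
rewrite -mulN1r -RintegralZl//.
by apply: eq_Rintegral => x _; case: (f x) => a b /=; rewrite mulN1r.
Qed.

Definition cmeas f := measurable_fun setT (fun x => Re (f x)) /\
  measurable_fun setT (fun x => Im (f x)).

Definition csqint f : \bar R :=
  (sqint mu (fun x => Re (f x)) + sqint mu (fun x => Im (f x)))%E.

Let measurable_sqint (f : 'rV[R]_n -> R) : measurable_fun setT f ->
  (mu.-integrable setT (EFin \o (fun x => f x ^+ 2)) <-> (sqint mu f < +oo)%E).
Proof.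
move=> mf; have E : sqint mu f = (\int[mu]_x `|(f x ^+ 2)%:E|)%E.
  by apply: eq_integral => x _; rewrite gee0_abs// lee_fin sqr_ge0.
split => [/integrableP[_]|foo]; first by rewrite E.
apply/integrableP; split; last by rewrite -E.
by apply/measurable_EFinP; exact: measurable_funX.
Qed.

Let Lfun2P (f : 'rV[R]_n -> R) : f \in Lfun mu 2%:E <->
  measurable_fun setT f /\ (sqint mu f < +oo)%E.
Proof.
have E : measurable_fun setT f ->
    (Lnorm mu 2%:E (EFin \o f) `^ 2 = sqint mu f)%E.
  move=> mf; rewrite powR_Lnorm//; apply: eq_integral => x _.
  by rewrite /= powR_mulrn// real_normK// num_real.
split=> [|[mf foo]].
  rewrite inE => /andP[]; rewrite !inE/= => mf foo; split=> //.
  by rewrite -E//; exact: poweR_lty.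
rewrite inE; apply/andP; split; rewrite inE//=.
by apply: (@lty_poweRy _ _ 2); rewrite ?pnatr_eq0// E.
Qed.

Lemma L2P f : L2 f <-> cmeas f /\ (csqint f < +oo)%E.
Proof.
split=> [[/Lfun2P[m1 h1] /Lfun2P[m2 h2]]|[[m1 m2]]].
  by split; [split|rewrite /csqint lte_add_pinfty].
rewrite /csqint => h; split; apply/Lfun2P; split=> //; apply: le_lt_trans h.
  by rewrite leeDl// sqint_ge0.
by rewrite leeDr// sqint_ge0.
Qed.

Lemma L2_cmeas f : L2 f -> cmeas f. Proof. by move=> /L2P[]. Qed.

Lemma csqint_ge0 f : (0 <= csqint f)%E.
Proof. by rewrite adde_ge0// sqint_ge0. Qed.

Lemma csqint_fineK f : L2 f -> (fine (csqint f))%:E = csqint f.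
Proof. by move=> /L2P[_ h]; rewrite fineK// ge0_fin_numE// csqint_ge0. Qed.

Lemma L2_mul_integrable (f g : 'rV[R]_n -> R) :
  f \in Lfun mu 2%:E -> g \in Lfun mu 2%:E ->
  mu.-integrable setT (EFin \o (fun x => f x * g x)).
Proof. by move=> hf hg; apply/Lfun1_integrable; exact: Lfun2_mul_Lfun1. Qed.

Lemma L2_mul_conj f g : L2 f -> L2 g -> torus_integrable (fun x => f x * conjc (g x)).
Proof.
move=> [fr fi] [gr gi].
have [i1 _] := isum 1 1 (L2_mul_integrable fr gr) (L2_mul_integrable fi gi).
have [i2 _] := isum 1 (-1) (L2_mul_integrable fi gr) (L2_mul_integrable fr gi).
split.
- rewrite (_ : (fun x => _) = EFin \o
    (fun x => 1 * (Re (f x) * Re (g x)) + 1 * (Im (f x) * Im (g x))))//.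
  by apply/funext => x /=; congr EFin; rewrite cReM; case: (g x) => a b /=; ring.
- rewrite (_ : (fun x => _) = EFin \o
    (fun x => 1 * (Im (f x) * Re (g x)) + -1 * (Re (f x) * Im (g x))))//.
  by apply/funext => x /=; congr EFin; rewrite cImM; case: (g x) => a b /=; ring.
Qed.

Lemma L2_bounded f (M : R) : cmeas f -> (forall x, cnorm (f x) <= M) -> L2 f.
Proof.
move=> [mr mi] fM.
have H (u : 'rV[R]_n -> R) : measurable_fun setT u -> (forall x, `|u x| <= M) ->
    u \in Lfun mu 2%:E.
  move=> mu_ uM; apply/Lfun2P; split=> //; apply/measurable_sqint => //.
  apply: (@torus_bounded_integrable _ _ _ (M ^+ 2)).
    exact: measurable_funX.
  by move=> x; rewrite normrX lerXn2r// nnegrE// (le_trans _ (uM x)).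
split; apply: H => // x; apply: le_trans (fM x).
  exact: normr_Re.
exact: normr_Im.
Qed.

Lemma cmeas_lin c f g : cmeas f -> cmeas g -> cmeas (fun x => c * f x + g x).
Proof.
move=> [fr fi] [gr gi]; split.
- rewrite (_ : (fun x => _) = (fun x => (Re c * Re (f x) + - Im c * Im (f x)) + Re (g x))).
    by apply: measurable_funD => //; apply: measurable_funD; apply: measurable_funM.
  by apply/funext => x; rewrite cReD cReM; ring.
- rewrite (_ : (fun x => _) = (fun x => (Re c * Im (f x) + Im c * Re (f x)) + Im (g x))).
    by apply: measurable_funD => //; apply: measurable_funD; apply: measurable_funM.
  by apply/funext => x; rewrite cImD cImM; ring.
Qed.

Lemma csqintD f g : cmeas f -> cmeas g ->
  (csqint (fun x => (f x + g x)%R) <= 2%:E * (csqint f + csqint g))%E.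
Proof.
move=> [fr fi] [gr gi]; rewrite /csqint.
have -> : (fun x => Re (f x + g x)) = (fun x => Re (f x) + Re (g x)).
  by apply/funext => x; rewrite cReD.
have -> : (fun x => Im (f x + g x)) = (fun x => Im (f x) + Im (g x)).
  by apply/funext => x; rewrite cImD.
apply: le_trans (leeD (sqintD _ fr gr) (sqintD _ fi gi)) _.
rewrite -ge0_muleDr; first by rewrite addeACA.
  exact: adde_ge0 (sqint_ge0 _ _) (sqint_ge0 _ _).
exact: adde_ge0 (sqint_ge0 _ _) (sqint_ge0 _ _).
Qed.

Lemma csqint_real f : L2 f ->
  csqint f = (Re (torus_int (fun x => (f x * conjc (f x))%R)))%:E.
Proof.
move=> [fr fi].
have ir := L2_mul_integrable fr fr; have ii := L2_mul_integrable fi fi.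
have [i0 e0] := isum 1 1 ir ii.
have -> : Re (torus_int (fun x => f x * conjc (f x))) =
    \int[mu]_x (1 * (Re (f x) * Re (f x)) + 1 * (Im (f x) * Im (f x))).
  apply: eq_Rintegral => x _; rewrite cReM; case: (f x) => a b /=; ring.
rewrite e0 !mul1r EFinD /csqint; congr (_ + _)%E.
- rewrite /Rintegral fineK; last exact: (integrable_fin_num measurableT ir).
  by apply: eq_integral => x _; rewrite expr2.
- rewrite /Rintegral fineK; last exact: (integrable_fin_num measurableT ii).
  by apply: eq_integral => x _; rewrite expr2.
Qed.

Lemma csqintZ c f : L2 f ->
  csqint (fun x => (c * f x)%R) = ((cnorm c ^+ 2)%:E * csqint f)%E /\
  L2 (fun x => c * f x).
Proof.
move=> Lf.
have mcf : cmeas (fun x => c * f x).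
  have := cmeas_lin c (L2_cmeas Lf) (L2_cmeas (@L2_bounded (fun=> 0) 0 _ _)).
  have -> : (fun x => c * f x + 0) = fun x => c * f x.
    by apply/funext => x; rewrite addr0.
  apply; last by move=> x; rewrite cnorm0.
  by split; exact: measurable_cst.
have E : csqint (fun x => c * f x) = ((cnorm c ^+ 2)%:E * csqint f)%E.
  have [mr mi] := L2_cmeas Lf; have [mcr mci] := mcf.
  have mX (u : 'rV[R]_n -> R) : measurable_fun setT u ->
    measurable_fun setT (fun x => (u x ^+ 2)%:E).
    by move=> mu_; apply/measurable_EFinP; exact: measurable_funX.
  rewrite /csqint /sqint -!ge0_integralD//; try exact: mX.
  all: try by move=> x _; rewrite lee_fin sqr_ge0.
  rewrite -ge0_integralZl//; last 3 first.
  - by apply: emeasurable_funD; exact: mX.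
  - by move=> x _; rewrite adde_ge0// lee_fin sqr_ge0.
  - by rewrite lee_fin sqr_ge0.
  apply: eq_integral => x _; rewrite -!EFinD -EFinM -!cnorm_sqr; congr EFin.
  by rewrite cnormM exprMn.
split=> //; apply/L2P; split=> //.
rewrite E; have /L2P[_ h] := Lf.
by rewrite lte_mul_pinfty// ?lee_fin ?sqr_ge0.
Qed.

Lemma L2_lin c f g : L2 f -> L2 g -> L2 (fun x => c * f x + g x).
Proof.
move=> Lf Lg; have [_ Lcf] := csqintZ c Lf.
apply/L2P; split; first by apply: cmeas_lin; exact: L2_cmeas.
apply: le_lt_trans (csqintD (L2_cmeas Lcf) (L2_cmeas Lg)) _.
have /L2P[_ h1] := Lcf; have /L2P[_ h2] := Lg.
by rewrite lte_mul_pinfty// lte_add_pinfty.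
Qed.

Lemma L2_0 : L2 (fun _ : 'rV[R]_n => 0 : R[i]).
Proof.
apply: (@L2_bounded _ 0) => [|x]; last by rewrite cnorm0.
by split; exact: measurable_cst.
Qed.

Lemma L2_sum (I : Type) (r : seq I) (c : I -> R[i]) (F : I -> 'rV[R]_n -> R[i]) :
  (forall k, L2 (F k)) -> L2 (fun x => \sum_(k <- r) c k * F k x).
Proof.
move=> hF; elim: r => [|k r IH].
  have -> : (fun x : 'rV[R]_n => \sum_(k <- [::]) c k * F k x) = fun=> 0.
    by apply/funext => x; rewrite big_nil.
  exact: L2_0.
have -> : (fun x : 'rV[R]_n => \sum_(k <- k :: r) c k * F k x) =
    fun x => c k * F k x + \sum_(k <- r) c k * F k x.
  by apply/funext => x; rewrite big_cons.
exact: L2_lin.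
Qed.

Lemma L2_integrable f : L2 f -> torus_integrable f.
Proof.
have L1 : L2 (fun _ : 'rV[R]_n => 1 : R[i]).
  apply: (@L2_bounded _ 1) => [|x]; first by split; exact: measurable_cst.
  by rewrite (cnorm_real ler01).
move=> Lf; have := L2_mul_conj Lf L1.
by under eq_fun do rewrite conjc1 mulr1.
Qed.

Lemma L2norm_csqint f : cmeas f -> L2norm f = (csqint f `^ 2^-1)%E.
Proof.
move=> [mr mi].
have E : (L2norm f `^ 2 = csqint f)%E.
  rewrite /L2norm powR_Lnorm//.
  have mX (u : 'rV[R]_n -> R) : measurable_fun setT u ->
    measurable_fun setT (fun x => (u x ^+ 2)%:E).
    by move=> mu_; apply/measurable_EFinP; exact: measurable_funX.
  rewrite /csqint /sqint -ge0_integralD//; try exact: mX.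
  all: try by move=> x _; rewrite lee_fin sqr_ge0.
  apply: eq_integral => x _.
  by rewrite -EFinD -cnorm_sqr /= ger0_norm ?cnorm_ge0// powR_mulrn// cnorm_ge0.
by rewrite -E -poweRrM mulfV ?poweRe1// ?Lnorm_ge0// pnatr_eq0.
Qed.

Lemma csqint_eq0 f : cmeas f -> csqint f = 0%E -> {ae mu, forall x, f x = 0}.
Proof.
move=> [mr mi] /eqP; rewrite padde_eq0 ?sqint_ge0// => /andP[/eqP h1 /eqP h2].
have := sqint_eq0 mi h2; apply: filterS2 (sqint_eq0 mr h1) => x r0 i0.
exact: complex_ReIm_eq.
Qed.

End complex_integral.

(** * Almost orthogonality *)

Section schur.
Context (R : realType) (n : nat).
Local Notation mu := (torus_measure R n).
Local Notation lattice := ('rV[int]_n).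
Local Notation weight := (@lattice_weight R n).
Implicit Types (f g h : 'rV[R]_n -> R[i]) (c : lattice -> R[i]).
Implicit Types (K J : {fset lattice}) (A : lattice -> 'rV[R]_n -> R[i]).

(** The integral is not normalised; the factor [(2 pi)^-n] of the Fourier coefficients is carried
    separately. *)
Definition inner f g : R[i] := torus_int (fun x => f x * conjc (g x)).

Lemma inner_linl (a : R[i]) f g h : L2 f -> L2 g -> L2 h ->
  inner (fun x => a * f x + g x) h = a * inner f h + inner g h.
Proof.
move=> Lf Lg Lh; rewrite /inner.
have [_ <-] := torus_integrable_lin a (L2_mul_conj Lf Lh) (L2_mul_conj Lg Lh).
by congr torus_int; apply/funext => x; rewrite mulrDl mulrA.
Qed.

Lemma inner_conj f g : L2 f -> L2 g -> inner g f = conjc (inner f g).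
Proof.
move=> Lf Lg; rewrite /inner -torus_int_conj; last exact: L2_mul_conj.
by congr torus_int; apply/funext => x; rewrite rmorphM/= conjcK mulrC.
Qed.

Lemma inner_suml K c A g : (forall k, L2 (A k)) -> L2 g ->
  inner (fun x => \sum_(k <- K) c k * A k x) g = \sum_(k <- K) c k * inner (A k) g.
Proof.
move=> LA Lg; rewrite /inner.
have [_ <-] := torus_int_sum K c (fun k => L2_mul_conj (LA k) Lg).
by congr torus_int; apply/funext => x; rewrite mulr_suml; apply: eq_bigr => k _; rewrite mulrA.
Qed.

Lemma inner_sumr K c A g : (forall k, L2 (A k)) -> L2 g ->
  inner g (fun x => \sum_(k <- K) c k * A k x) =
  \sum_(k <- K) conjc (c k) * inner g (A k).
Proof.
move=> LA Lg; rewrite inner_conj//; last exact: L2_sum.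
rewrite inner_suml// rmorph_sum/=; apply: eq_bigr => k _.
by rewrite rmorphM/= (inner_conj (LA k) Lg).
Qed.

Lemma csqint_inner f : L2 f -> csqint f = (Re (inner f f))%:E.
Proof. exact: csqint_real. Qed.

(** From [|c_k c_l| <= (|c_k|^2 + |c_l|^2) / 2] the double sum splits into a row part and a column
    part. The weight is even, so both reduce to the same sum, with the factor [8 ^+ n]. *)
Lemma schur_test K c (G : lattice -> lattice -> R[i]) (B : R) : 0 <= B ->
  (forall k l, cnorm (G k l) <= B * weight (k - l)) ->
  cnorm (\sum_(k <- K) c k * (\sum_(l <- K) conjc (c l) * G k l)) <=
  B * 8 ^+ n * \sum_(k <- K) cnorm (c k) ^+ 2.
Proof.
move=> B0 hG.
have W0 k : 0 <= weight k by exact: lattice_weight_ge0.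
pose s k := cnorm (c k) ^+ 2.
have s0 k : 0 <= s k by exact: sqr_ge0.
have H : cnorm (\sum_(k <- K) c k * (\sum_(l <- K) conjc (c l) * G k l)) <=
    \sum_(k <- K) \sum_(l <- K) (B / 2) * (s k * weight (k - l) + s l * weight (l - k)).
  apply: le_trans (cnorm_sum _ _) _; apply: ler_sum => k _.
  rewrite mulr_sumr; apply: le_trans (cnorm_sum _ _) _; apply: ler_sum => l _.
  rewrite !cnormM cnorm_conj -[in weight (l - k)]opprB lattice_weightN -mulrDl.
  have := hG k l; have := W0 (k - l); have := cnorm_ge0 (G k l).
  have := sqr_ge0 (cnorm (c k) - cnorm (c l)); rewrite /s.
  have := cnorm_ge0 (c k); have := cnorm_ge0 (c l).
  move: (cnorm (c k)) (cnorm (c l)) (cnorm (G k l)) (weight (k - l)) => x y z w.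
  move=> y0 x0 xy z0 w0 zw.
  have xy2 : x * y <= (x ^+ 2 + y ^+ 2) / 2 by move: xy; rewrite !expr2; nra.
  rewrite mulrA (_ : B / 2 * _ = (x ^+ 2 + y ^+ 2) / 2 * (B * w)); last by ring.
  by apply: ler_pM => //; rewrite mulr_ge0.
apply: le_trans H _.
under eq_bigr do rewrite -mulr_sumr big_split/=.
rewrite -mulr_sumr big_split/= [X in _ + X]exchange_big/=.
have H1 : \sum_(k <- K) \sum_(l <- K) s k * weight (k - l) <=
    8 ^+ n * \sum_(k <- K) s k.
  rewrite mulr_sumr; apply: ler_sum => k _; rewrite -mulr_sumr mulrC ler_wpM2r//.
  under eq_bigr do rewrite -lattice_weightN opprB.
  exact: sum_lattice_weight.
apply: (@le_trans _ _ (B / 2 * (8 ^+ n * (\sum_(k <- K) s k) + 8 ^+ n * (\sum_(k <- K) s k)))).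
  by rewrite ler_wpM2l ?divr_ge0// lerD.
by rewrite le_eqVlt; apply/orP; left; apply/eqP; rewrite /s; field.
Qed.

(** Strict positivity of [B] is required because Bessel's inequality divides by it. *)
Definition gram_bounded A (B : R) :=
  [/\ 0 < B, forall k, L2 (A k) &
      forall k l, cnorm (inner (A k) (A l)) <= B * weight (k - l)].

Lemma synthesis_bound A (B : R) K c : gram_bounded A B ->
  (csqint (fun x => (\sum_(k <- K) c k * A k x)%R) <=
   (B * 8 ^+ n * \sum_(k <- K) cnorm (c k) ^+ 2)%R%:E)%E.
Proof.
move=> [B0 LA hA]; rewrite csqint_inner; last exact: L2_sum.
rewrite lee_fin inner_suml//; last exact: L2_sum.
under eq_bigr => k _ do rewrite inner_sumr//.
apply: le_trans (schur_test K c (ltW B0) hA).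
exact: le_trans (ler_norm _) (normr_Re _).
Qed.

(* Testing [0 <= |f - t g|^2] with [g = \sum_k <f, e_k> e_k]: the synthesis    *)
(* bound alone yields Bessel's inequality, up to a constant.                   *)
Lemma bessel A (B : R) f K : gram_bounded A B -> L2 f ->
  ((\sum_(k <- K) cnorm (inner f (A k)) ^+ 2)%R%:E <=
   (B * 8 ^+ n)%R%:E * csqint f)%E.
Proof.
move=> gA Lf; have [B0 LA hA] := gA.
pose c k := inner f (A k).
pose g x := \sum_(k <- K) c k * A k x.
have Lg : L2 g by exact: L2_sum.
pose S := \sum_(k <- K) cnorm (c k) ^+ 2.
pose M := B * 8 ^+ n.
have M0 : 0 < M by rewrite mulr_gt0// exprn_gt0.
have ifg : inner f g = S%:C.
  rewrite inner_sumr// /S rmorph_sum/=; apply: eq_bigr => k _.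
  by rewrite mulrC mulC_conj.
have igf : inner g f = S%:C by rewrite inner_conj// ifg conjc_real.
(* For real [t] the squared norm of [t g + f] is at most [t^2 M S + 2 t S + |f|^2], and [t = -1 / M]
   minimises this. *)
pose t : R[i] := (- M^-1)%:C.
pose h x := t * g x + f x.
have Lh : L2 h by exact: L2_lin.
have Ehh : inner h h = t * (conjc (t * inner g g + inner f g)) + conjc (t * inner g f + inner f f).
  rewrite {1}/h inner_linl//; congr (_ * _ + _).
    by rewrite inner_conj// /h inner_linl.
  by rewrite inner_conj// /h inner_linl.
have h0 : 0 <= Re (inner h h).
  by rewrite -lee_fin -csqint_inner// csqint_ge0.
have Fg : Re (inner g g) <= M * S.
  by rewrite -lee_fin -csqint_inner//; exact: synthesis_bound.
rewrite csqint_inner// -EFinM lee_fin -/M.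
change (S <= M * Re (inner f f)).
have E : Re (inner h h) = M^-1 ^+ 2 * Re (inner g g) - 2 * M^-1 * S + Re (inner f f).
  rewrite Ehh ifg igf; move: (inner g g) (inner f f) => [a b] [a' b'].
  rewrite /t /=; ring.
rewrite E in h0.
have MV0 : 0 < M^-1 by rewrite invr_gt0.
have h1 : 0 <= M^-1 ^+ 2 * (M * S) - 2 * M^-1 * S + Re (inner f f).
  apply: le_trans h0 _; rewrite lerD2r lerD2r ler_wpM2l// sqr_ge0 //.
rewrite (_ : _ - _ = - (M^-1 * S)) in h1; last by field; rewrite gt_eqF.
rewrite -ler_pdivrMl//; lra.
Qed.

Lemma fset_sum_split (V : nmodType) J K (F : lattice -> V) : fsubset J K ->
  \sum_(k <- K) F k = \sum_(k <- J) F k + \sum_(k <- (K `\` J)%fset) F k.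
Proof.
move=> JK; rewrite -big_cat; apply: perm_big; apply: uniq_perm.
- exact: fset_uniq.
- rewrite cat_uniq !fset_uniq/= andbT; apply/hasPn => k.
  by rewrite inE => /andP[].
- move=> k; rewrite mem_cat in_fsetD.
  case: (boolP (k \in J)) => //= kJ; exact: (fsubsetP JK).
Qed.

Local Notation J := (@exhaustion n).

(** The coefficients that separate two partial sums have total square [beta N' - beta N], at most
    [b - beta N] with [b] the supremum: an error depending on the smaller index alone, the form that
    [sqint_complete] asks for. *)
Lemma synthesis_exists A (B D : R) c : gram_bounded A B ->
  (forall K, \sum_(k <- K) cnorm (c k) ^+ 2 <= D) ->
  exists2 g, L2 g & forall e : R, 0 < e -> exists N, forall m, (N <= m)%N ->
    (csqint (fun x => (g x - \sum_(k <- J m) c k * A k x)%R) <= e%:E)%E.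
Proof.
move=> gA hD; have [B0 LA hA] := gA.
pose beta N := \sum_(k <- J N) cnorm (c k) ^+ 2.
pose M := B * 8 ^+ n.
have M0 : 0 < M by rewrite mulr_gt0// exprn_gt0.
have bmono N N' : (N <= N')%N -> beta N <= beta N'.
  move=> NN'; rewrite /beta (fset_sum_split _ (exhaustion_sub n NN')) lerDl.
  by apply: sumr_ge0 => k _; exact: sqr_ge0.
have bsup : has_sup (range beta).
  by split; [exists (beta 0%N), 0%N|exists D => _ [N _ <-]; exact: hD].
pose b := sup (range beta).
have bb N : beta N <= b by apply: sup_upper_bound => //; exists N.
pose s m x := \sum_(k <- J m) c k * A k x.
have Ls m : L2 (s m) by exact: L2_sum.
have sdiff N N' : (N <= N')%N ->
    (csqint (fun x => (s N' x - s N x)%R) <= (M * (b - beta N))%R%:E)%E.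
  move=> NN'; have JJ := exhaustion_sub n NN'.
  have -> : (fun x => s N' x - s N x) =
      fun x => \sum_(k <- (J N' `\` J N)%fset) c k * A k x.
    by apply/funext => x; rewrite /s (fset_sum_split _ JJ) addrC addKr.
  apply: le_trans (synthesis_bound _ _ gA) _; rewrite lee_fin ler_pM2l//.
  have := bb N'; rewrite {1}/beta (fset_sum_split _ JJ) -/(beta N); lra.
have heps e : 0 < e -> exists N, forall m, (N <= m)%N -> M * (b - beta m) <= e.
  move=> e0; have eM : 0 < e / M by rewrite divr_gt0.
  have [_ [N _ <-] hN] := sup_adherent eM bsup.
  exists N => m Nm; have := bmono _ _ Nm => h.
  rewrite -ler_pdivlMl// mulrC; rewrite -/b in hN; lra.
have mR m : measurable_fun setT (fun x => Re (s m x)) by case: (L2_cmeas (Ls m)).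
have mI m : measurable_fun setT (fun x => Im (s m x)) by case: (L2_cmeas (Ls m)).
have subE N N' : csqint (fun x => (s N' x - s N x)%R) =
    (sqint mu (fun x => (Re (s N' x) - Re (s N x))%R) +
     sqint mu (fun x => (Im (s N' x) - Im (s N x))%R))%E.
  rewrite /csqint; congr (sqint mu _ + sqint mu _)%E; apply/funext => x.
    by rewrite cReD cReN.
  by rewrite cImD cImN.
have sR N N' : (N <= N')%N ->
    (sqint mu (fun x => (Re (s N' x) - Re (s N x))%R) <= (M * (b - beta N))%R%:E)%E.
  move=> NN'; apply: le_trans (sdiff _ _ NN'); rewrite subE.
  exact: leeDl (sqint_ge0 _ _).
have sI N N' : (N <= N')%N ->
    (sqint mu (fun x => (Im (s N' x) - Im (s N x))%R) <= (M * (b - beta N))%R%:E)%E.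
  move=> NN'; apply: le_trans (sdiff _ _ NN'); rewrite subE.
  exact: leeDr (sqint_ge0 _ _).
have [gr mgr hgr] := sqint_complete mR sR heps.
have [gi mgi hgi] := sqint_complete mI sI heps.
pose g x := gr x +i* gi x.
(* The factor 2 arises because real and imaginary parts were completed separately, each with error
   [M * (b - beta m)]. *)
have gsE m : (csqint (fun x => (g x - s m x)%R) <= (2 * (M * (b - beta m)))%R%:E)%E.
  have -> : csqint (fun x => (g x - s m x)%R) =
      (sqint mu (fun x => (gr x - Re (s m x))%R) + sqint mu (fun x => (gi x - Im (s m x))%R))%E.
    rewrite /csqint; congr (sqint mu _ + sqint mu _)%E; apply/funext => x.
      by rewrite cReD cReN.
    by rewrite cImD cImN.
  rewrite mulr_natl mulr2n EFinD; exact: leeD (hgr m) (hgi m).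
have cg : cmeas g by split.
have cgs : cmeas (fun x => g x - s 0%N x).
  have := cmeas_lin (-1) (L2_cmeas (Ls 0%N)) cg.
  by under eq_fun do rewrite mulN1r addrC.
exists g.
  apply/L2P; split=> //.
  have -> : g = fun x => (g x - s 0%N x) + s 0%N x by apply/funext => x; rewrite subrK.
  apply: le_lt_trans (csqintD cgs (L2_cmeas (Ls 0%N))) _.
  have /L2P[_ h0] := Ls 0%N.
  by rewrite lte_mul_pinfty// lte_add_pinfty// (le_lt_trans (gsE 0%N))// ltry.
move=> e e0; have e20 : 0 < e / 2 by rewrite divr_gt0.
have [N hN] := heps (e / 2) e20.
exists N => m Nm; apply: le_trans (gsE m) _; rewrite lee_fin.
have := hN m Nm; lra.
Qed.

(* The operator is characterized by its approximations, so the values of [S]   *)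
(* may be chosen by [synthesis_exists], and linearity holds almost everywhere. *)
Lemma analysis_synthesis_bounded A E (B B' : R) (kappa : R[i]) :
  gram_bounded A B -> gram_bounded E B' ->
  exists S, bounded_L2_operator S /\ forall f, L2 f ->
    L2 (S f) /\ forall e : R, 0 < e -> exists N, forall m, (N <= m)%N ->
    (csqint (fun x => (S f x - \sum_(k <- J m) kappa * inner f (E k) * A k x)%R)
      <= e%:E)%E.
Proof.
move=> gA gE; have [B0 LA hA] := gA; have [B'0 LE hE] := gE.
have e80 : 0 <= 8 ^+ n :> R by rewrite exprn_ge0.
have Bn0 : 0 <= B * 8 ^+ n by rewrite mulr_ge0// ltW.
have B'n0 : 0 <= B' * 8 ^+ n by rewrite mulr_ge0// ltW.
pose c f k := kappa * inner f (E k).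
pose s f m x := \sum_(k <- J m) c f k * A k x.
pose MB := cnorm kappa ^+ 2 * (B' * 8 ^+ n).
have MB0 : 0 <= MB by rewrite mulr_ge0// sqr_ge0.
have coef f K : L2 f -> \sum_(k <- K) cnorm (c f k) ^+ 2 <= MB * fine (csqint f).
  move=> Lf; under eq_bigr do rewrite /c cnormM exprMn.
  rewrite -mulr_sumr /MB -[leRHS]mulrA ler_wpM2l ?sqr_ge0//.
  by rewrite -lee_fin EFinM csqint_fineK//; exact: bessel.
have /choice[S hS] : forall f, exists g, L2 f -> L2 g /\
    forall e : R, 0 < e -> exists N, forall m, (N <= m)%N ->
    (csqint (fun x => (g x - s f m x)%R) <= e%:E)%E.
  (* Outside [L2] the value of [S] is arbitrary. *)
  move=> f; have [Lf|nLf] := pselect (L2 f); last by exists f.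
  have [g Lg hg] := synthesis_exists gA (fun K => coef f K Lf).
  by exists g.
have Ls f m : L2 f -> L2 (s f m) by move=> _; exact: L2_sum.
have L2B (u v : 'rV[R]_n -> R[i]) : L2 u -> L2 v -> L2 (fun x => u x - v x).
  by move=> Lu Lv; have := L2_lin (-1) Lv Lu; under eq_fun do rewrite mulN1r addrC.
have L2D (u v : 'rV[R]_n -> R[i]) : L2 u -> L2 v -> L2 (fun x => u x + v x).
  by move=> Lu Lv; have := L2_lin 1 Lu Lv; under eq_fun do rewrite mul1r.
exists S; split=> //; split.
- by move=> f /hS[].
- move=> a f g Lf Lg.
  have Lw : L2 (fun y => a * f y + g y) by exact: L2_lin.
  have [LSw hw] := hS _ Lw; have [LSf hf] := hS _ Lf; have [LSg hg] := hS _ Lg.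
  set w := fun y => a * f y + g y in Lw LSw hw *.
  have LaSf : L2 (fun x => a * S f x + S g x) by exact: L2_lin.
  pose h x := S w x - (a * S f x + S g x).
  have Lh : L2 h by exact: L2B.
  suff h0 : csqint h = 0%E.
    apply: filterS (csqint_eq0 (L2_cmeas Lh) h0) => x /eqP.
    by rewrite subr_eq0 => /eqP.
  have swE m x : s w m x = a * s f m x + s g m x.
    rewrite /s mulr_sumr -big_split/=; apply: eq_bigr => k _.
    by rewrite /c inner_linl//; ring.
  (* Partial sums depend linearly on the function, so they cancel and [h] is a combination of three
     approximation errors, each arbitrarily small. *)
  have hE_ m : h = fun x => (S w x - s w m x) + (- a * (S f x - s f m x) + - 1 * (S g x - s g m x)).
    by apply/funext => x; rewrite swE /h; ring.
  have bound m : (csqint h <= 2%:E * (csqint (fun x => (S w x - s w m x)%R) +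
      2%:E * ((cnorm a ^+ 2)%:E * csqint (fun x => (S f x - s f m x)%R) +
              csqint (fun x => (S g x - s g m x)%R))))%E.
    have L1 := L2B _ _ LSw (Ls w m Lw).
    have L2f := L2B _ _ LSf (Ls f m Lf); have L2g := L2B _ _ LSg (Ls g m Lg).
    have [e1 L1'] := csqintZ (- a) L2f; have [e2 L2'] := csqintZ (- 1) L2g.
    rewrite {1}(hE_ m).
    apply: le_trans (csqintD (L2_cmeas L1) (L2_cmeas (L2D _ _ L1' L2'))) _.
    apply: lee_wpmul2l => //; apply: leeD => //.
    apply: le_trans (csqintD (L2_cmeas L1') (L2_cmeas L2')) _.
    rewrite e1 e2 !cnorm_sqr !cReN !cImN !sqrrN/= expr1n expr0n addr0 mul1e.
    by rewrite -cnorm_sqr.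
  apply/eqP; rewrite eq_le csqint_ge0 andbT; apply/lee_addgt0Pr => e e0; rewrite add0e.
  (* The total coefficient in [bound]: three errors equal to [e / C0] add up to [e]. *)
  pose C0 := 2 * (1 + 2 * (cnorm a ^+ 2 + 1)).
  have C00 : 0 < C0.
    by rewrite mulr_gt0// addr_gt0// mulr_gt0// ltr_wpDl// sqr_ge0.
  have e'0 : 0 < e / C0 by rewrite divr_gt0.
  have [N1 h1] := hw _ e'0; have [N2 h2] := hf _ e'0; have [N3 h3] := hg _ e'0.
  pose m := maxn N1 (maxn N2 N3).
  apply: le_trans (bound m) _.
  apply: (@le_trans _ _ (2%:E * ((e / C0)%R%:E + 2%:E * ((cnorm a ^+ 2)%:E * (e / C0)%R%:E + (e / C0)%R%:E)))%E).
    apply: lee_wpmul2l => //; apply: leeD; first by apply: h1; rewrite leq_max leqnn.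
    apply: lee_wpmul2l => //; apply: leeD.
      by apply: lee_wpmul2l; [rewrite lee_fin sqr_ge0|apply: h2; rewrite !leq_max leqnn orbT].
    by apply: h3; rewrite !leq_max leqnn !orbT.
  rewrite !(=^~ EFinM, =^~ EFinD) lee_fin le_eqVlt; apply/orP; left.
  by apply/eqP; rewrite /C0; field; rewrite gt_eqF// -/C0; nra.
- pose M2 := 2 * (1 + B * 8 ^+ n * MB).
  have M20 : 0 <= M2 by rewrite mulr_ge0// addr_ge0// mulr_ge0.
  have key f : L2 f -> (csqint (S f) <= M2%:E * csqint f)%E.
    move=> Lf; have [LSf hf] := hS _ Lf.
    have main : (csqint (S f) <= (2 * (B * 8 ^+ n * MB))%R%:E * csqint f)%E.
      apply/lee_addgt0Pr => e e0.
      have e20 : 0 < e / 2 by rewrite divr_gt0.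
      have [N hN] := hf (e / 2) e20.
      have -> : S f = fun x => (S f x - s f N x) + s f N x.
        by apply/funext => x; rewrite subrK.
      apply: le_trans (csqintD (L2_cmeas (L2B _ _ LSf (Ls f N Lf))) (L2_cmeas (Ls f N Lf))) _.
      have b1 := hN N (leqnn N).
      have b2 : (csqint (s f N) <= (B * 8 ^+ n * (MB * fine (csqint f)))%R%:E)%E.
        apply: le_trans (synthesis_bound _ _ gA) _; by rewrite lee_fin ler_wpM2l ?coef.
      apply: le_trans (lee_wpmul2l _ (leeD b1 b2)) _ => //.
      rewrite -(csqint_fineK Lf) !(=^~ EFinM, =^~ EFinD) lee_fin.
      by rewrite le_eqVlt; apply/orP; left; apply/eqP; field.
    apply: le_trans main _; apply: lee_wpmul2r; first exact: csqint_ge0.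
    by rewrite lee_fin /M2; lra.
  exists (Num.sqrt M2) => f Lf; have [LSf _] := hS _ Lf.
  rewrite !L2norm_csqint; try exact: L2_cmeas.
  apply: (@le_trans _ _ ((M2%:E * csqint f) `^ 2^-1)%E).
    apply: gt0_ler_poweR; rewrite ?in_itv/= ?leey ?andbT ?csqint_ge0 ?mule_ge0 ?csqint_ge0 ?lee_fin ?invr_ge0//.
    exact: key.
  by rewrite poweRM ?csqint_ge0 ?lee_fin// poweR_EFin powR12_sqrt.
Qed.

End schur.

(** * Oscillating families *)

Section oscillatory_gram.
Context (R : realType) (n : nat).
Local Notation mu := (torus_measure R n).
Local Notation e_ j := (unit_vec R j).
Local Notation lattice := ('rV[int]_n).
Local Notation weight := (@lattice_weight R n).
Implicit Types (f g psi : 'rV[R]_n -> R).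

Lemma continuous_cos_comp psi : continuous psi -> continuous (fun x => cos (psi x)).
Proof. by move=> cp x; apply: (continuous_comp (cp x)); exact: continuous_cos. Qed.

Lemma continuous_sin_comp psi : continuous psi -> continuous (fun x => sin (psi x)).
Proof. by move=> cp x; apply: (continuous_comp (cp x)); exact: continuous_sin. Qed.

Lemma expi_periodic_cos_sin psi : torus_periodic (fun x => expi (psi x)) ->
  rV_periodic (fun x => cos (psi x)) /\ rV_periodic (fun x => sin (psi x)).
Proof. by move=> h; split => j x; have [] := h j x. Qed.

(* [d psi = cos psi d(sin psi) - sin psi d(cos psi)] only involves functions   *)
(* of [exp (i psi)].                                                           *)
Lemma partial_phase_periodic j psi : (forall x, derivable psi x (e_ j)) ->
  torus_periodic (fun x => expi (psi x)) -> rV_periodic (partial j psi).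
Proof.
move=> dpsi /expi_periodic_cos_sin[pc ps].
have dc x : partial j (fun x => cos (psi x)) x = - sin (psi x) * partial j psi x.
  by apply: derive_val; apply: is_derive_comp1; exact: derivableP.
have ds x : partial j (fun x => sin (psi x)) x = cos (psi x) * partial j psi x.
  by apply: derive_val; apply: is_derive_comp1; exact: derivableP.
have E x : partial j psi x = cos (psi x) * partial j (fun x => sin (psi x)) x -
    sin (psi x) * partial j (fun x => cos (psi x)) x.
  rewrite dc ds; transitivity ((cos (psi x) ^+ 2 + sin (psi x) ^+ 2) * partial j psi x).
    by rewrite cos2Dsin2 mul1r.
  by ring.
move=> i x; rewrite !E pc ps.
by rewrite (rV_periodic_partial j pc) (rV_periodic_partial j ps).
Qed.

Definition Cboundedc m (F : R) (a : 'rV[R]_n -> R[i]) :=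
  [/\ Cbounded m F (fun x => Re (a x)), Cbounded m F (fun x => Im (a x)) &
      torus_periodic a].

Lemma Cboundedc_mul_conj m (F : R) (a b : 'rV[R]_n -> R[i]) :
  Cboundedc m F a -> Cboundedc m F b ->
  Cboundedc m (2 * (2 ^+ m * F * F)) (fun x => a x * conjc (b x)).
Proof.
move=> [ar ai pa] [br bi pb]; rewrite mulr_natl mulr2n; split.
- apply: Cbounded_ext (CboundedD (CboundedM ar br) (CboundedM ai bi)) => x.
  by rewrite cReM; case: (b x) => ? ? /=; ring.
- apply: Cbounded_ext (CboundedD (CboundedN (CboundedM ar bi)) (CboundedM ai br)) => x.
  by rewrite cImM; case: (b x) => ? ? /=; ring.
- by move=> j x; rewrite pa pb.
Qed.

Lemma torus_periodic_Re_Im (a : 'rV[R]_n -> R[i]) : torus_periodic a ->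
  rV_periodic (fun x => Re (a x)) /\ rV_periodic (fun x => Im (a x)).
Proof. by move=> pa; split=> j x; rewrite pa. Qed.

Lemma cmeas_expiM psi m F (a : 'rV[R]_n -> R[i]) : continuous psi -> Cboundedc m F a ->
  cmeas (fun x => expi (psi x) * a x) /\
  forall x, cnorm (expi (psi x) * a x) <= F + F.
Proof.
move=> cpsi [ar ai _]; have cc := continuous_cos_comp cpsi.
have cs := continuous_sin_comp cpsi.
have cr := Cbounded_continuous ar; have ci := Cbounded_continuous ai.
split; last first.
  move=> x; rewrite cnormM cnorm_expi mul1r (le_trans (cnorm_le_ReIm _))// lerD//.
    exact: Cbounded_le ar x.
  exact: Cbounded_le ai x.
have M (f g : 'rV[R]_n -> R) : continuous f -> continuous g ->
  measurable_fun setT (fun x => f x * g x).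
  by move=> cf cg; apply: continuous_measurable_rV; exact: continuous_rVM.
split.
- rewrite (_ : (fun x => _) =
    (fun x => cos (psi x) * Re (a x) - sin (psi x) * Im (a x))).
    by apply: measurable_funB; exact: M.
  by apply/funext => x; rewrite cReM.
- rewrite (_ : (fun x => _) =
    (fun x => cos (psi x) * Im (a x) + sin (psi x) * Re (a x))).
    by apply: measurable_funD; exact: M.
  by apply/funext => x; rewrite cImM.
Qed.

Lemma torus_int_expiM psi m F (a : 'rV[R]_n -> R[i]) (X : R) :
  continuous psi -> Cboundedc m F a ->
  (forall f, f = (fun x => Re (a x)) \/ f = (fun x => Im (a x)) ->
    `|\int[mu]_x (cos (psi x) * f x)| <= X /\
    `|\int[mu]_x (sin (psi x) * f x)| <= X) ->
  cnorm (torus_int (fun x => expi (psi x) * a x)) <= 4 * X.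
Proof.
move=> cpsi [ar ai _] hX.
have [c1 s1] := hX _ (or_introl erefl); have [c2 s2] := hX _ (or_intror erefl).
have ib (t f : 'rV[R]_n -> R) : continuous t -> (forall x, `|t x| <= 1) ->
    Cbounded m F f -> mu.-integrable setT (EFin \o (fun x => t x * f x)).
  move=> ct tb Cf; apply: (@torus_bounded_integrable _ _ _ F).
    apply: continuous_measurable_rV; apply: continuous_rVM => //.
    exact: Cbounded_continuous Cf.
  move=> x; rewrite normrM -[F]mul1r; apply: ler_pM => //.
  exact: Cbounded_le Cf x.
have nc x : `|cos (psi x)| <= 1 by rewrite ler_norml cos_geN1 cos_le1.
have ns x : `|sin (psi x)| <= 1 by rewrite ler_norml sin_geN1 sin_le1.
have cc := continuous_cos_comp cpsi; have cs := continuous_sin_comp cpsi.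
apply: le_trans (cnorm_le_ReIm _) _; rewrite /torus_int/=.
rewrite (@eq_Rintegral _ _ _ _ _
  (fun x => cos (psi x) * Re (a x) - sin (psi x) * Im (a x))); last first.
  by move=> x _; rewrite cReM.
rewrite [X in _ + `|X|](@eq_Rintegral _ _ _ _ _
  (fun x => cos (psi x) * Im (a x) + sin (psi x) * Re (a x))); last first.
  by move=> x _; rewrite cImM.
rewrite RintegralB//; try exact: ib.
rewrite RintegralD//; try exact: ib.
rewrite (_ : 4 * X = (X + X) + (X + X)); last by ring.
apply: lerD.
  by apply: le_trans (ler_normB _ _) _; exact: lerD.
by apply: le_trans (ler_normD _ _) _; exact: lerD.
Qed.

(** The conditions are shared by [phi] and by the phase [k . x] of the plane waves, so one estimate
    serves both. The quantitative ones bear on differences of gradients, which are periodic, and can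
    therefore be imposed on the whole space. *)
Definition nonstationary (P c : R) (phi : 'rV[R]_n -> lattice -> R) :=
  [/\ forall k, continuous (fun x => phi x k),
      forall k j x, derivable (fun x => phi x k) x (e_ j),
      forall k, torus_periodic (fun x => expi (phi x k)),
      forall k l j, Cbounded (2 * n) (P * enorm (latticeR R (k - l)))
        (fun x => partial j (fun y => phi y k) x - partial j (fun y => phi y l) x) &
      forall k l x, c * enorm (latticeR R (k - l)) ^+ 2 <=
        \sum_j (partial j (fun y => phi y k) x - partial j (fun y => phi y l) x) ^+ 2].

(** Dividing the gradient of [phi_k - phi_l] by [r = |k - l|] normalises it: the bounds [P] and [c]
    then hold for all pairs at once, and a single constant covers all of them. *)
Lemma nonstationary_decay (P c : R) phi : 0 <= P -> 0 < c -> nonstationary P c phi ->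
  exists2 B : R, 0 <= B & forall k l F a, Cboundedc (2 * n) F a ->
  cnorm (torus_int (fun x => expi (phi x k - phi x l) * a x)) <=
  B * F * weight (k - l).
Proof.
move=> P0 c0 [cphi dphi pphi bphi sphi].
have [B0 B00 hB0] := @nonstationary_phase R n (2 * n) P c P0 c0.
pose m := fine (mu setT); have m0 : 0 <= m by exact: fine_ge0.
have B200 : 0 <= B0 * 2 ^+ n by rewrite mulr_ge0// exprn_ge0.
exists (4 * (B0 * 2 ^+ n + m)); first by rewrite mulr_ge0// addr_ge0.
move=> k l F a Ca; have [ar ai pa] := Ca.
have F0 : 0 <= F by exact: Cbounded_ge0 ar.
have [par pai] := torus_periodic_Re_Im pa.
have cpsi : continuous (fun x => phi x k - phi x l).
  by move=> x; exact: (continuousB (cphi k x) (cphi l x)).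
suff [X hX XB] : exists2 X : R,
    (forall f, f = (fun x => Re (a x)) \/ f = (fun x => Im (a x)) ->
    `|\int[mu]_x (cos (phi x k - phi x l) * f x)| <= X /\
    `|\int[mu]_x (sin (phi x k - phi x l) * f x)| <= X) &
    X <= (B0 * 2 ^+ n + m) * F * weight (k - l).
  apply: le_trans (torus_int_expiM cpsi Ca hX) _.
  by rewrite -!mulrA ler_wpM2l// !mulrA.
have H f : f = (fun x => Re (a x)) \/ f = (fun x => Im (a x)) ->
    Cbounded (2 * n) F f /\ rV_periodic f by case=> ->.
(* On the diagonal there is no oscillation; the weight is 1 and the total mass of the torus
   suffices. *)
have [kl|kl] := eqVneq k l.
  exists (F * m); last first.
    by rewrite kl subrr lattice_weight0 mulr1 mulrC ler_wpM2r// lerDr.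
  move=> f /H[Cf _]; have cf := Cbounded_continuous Cf.
  split; apply: le_Rintegral_torus.
  - by apply: continuous_measurable_rV; apply: continuous_rVM => //; exact: continuous_cos_comp.
  - move=> x; rewrite normrM -[F]mul1r; apply: ler_pM => //.
      by rewrite ler_norml cos_geN1 cos_le1.
    exact: Cbounded_le Cf x.
  - by apply: continuous_measurable_rV; apply: continuous_rVM => //; exact: continuous_sin_comp.
  - move=> x; rewrite normrM -[F]mul1r; apply: ler_pM => //.
      by rewrite ler_norml sin_geN1 sin_le1.
    exact: Cbounded_le Cf x.
have kl0 : k - l != 0 by rewrite subr_eq0.
set r := enorm (latticeR R (k - l)).
have r0 : 0 < r by apply: lt_le_trans (enorm_lattice_ge1 R kl0).
exists (B0 * F / r ^+ (2 * n)); last first.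
  apply: (@le_trans _ _ (B0 * F * (2 ^+ n * weight (k - l)))).
    by rewrite ler_wpM2l ?mulr_ge0// enorm_lattice_weight.
  rewrite !mulrDl (_ : B0 * F * (2 ^+ n * weight (k - l)) = B0 * 2 ^+ n * F * weight (k - l)); last by ring.
  by rewrite lerDl !mulr_ge0// lattice_weight_ge0.
pose d j x := partial j (fun y => phi y k) x - partial j (fun y => phi y l) x.
pose p j x := r^-1 * d j x.
have rp j x : r * p j x = d j x by rewrite /p mulVKf// gt_eqF.
have [pck psk] := expi_periodic_cos_sin (pphi k).
have [pcl psl] := expi_periodic_cos_sin (pphi l).
move=> f /H[Cf pf].
apply: (hB0 r F (fun x => phi x k - phi x l) p f) => //.
- move=> j x; rewrite rp; apply: is_deriveB; exact: derivableP.
- by move=> j x; rewrite !cosB pck psk pcl psl.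
- by move=> j x; rewrite !sinB pck psk pcl psl.
- move=> j; have := CboundedZ r^-1 (bphi k l j).
  by rewrite -/r ger0_norm ?invr_ge0 ?(ltW r0)// mulrCA mulVf ?mulr1// gt_eqF.
- move=> j i x; rewrite /p /d (partial_phase_periodic (dphi k j) (pphi k)).
  by rewrite (partial_phase_periodic (dphi l j) (pphi l)).
- move=> x; under eq_bigr do rewrite exprMn.
  rewrite -mulr_sumr exprVn ler_pdivlMl ?exprn_gt0// mulrC; exact: sphi.
Qed.

Lemma nonstationary_gram (P c F : R) phi (a : 'rV[R]_n -> lattice -> R[i]) :
  0 <= P -> 0 < c -> nonstationary P c phi ->
  (forall k, Cboundedc (2 * n) F (fun x => a x k)) ->
  exists B, gram_bounded (fun k x => expi (phi x k) * a x k) B.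
Proof.
move=> P0 c0 ns Ca; have [B B0 hB] := nonstationary_decay P0 c0 ns.
have [cphi _ _ _ _] := ns.
pose F' := 2 * (2 ^+ (2 * n) * F * F).
have F'0 : 0 <= F'.
  by have [h _ _] := Cboundedc_mul_conj (Ca 0) (Ca 0); exact: Cbounded_ge0 h.
(* Adding 1 provides the strict positivity demanded by [gram_bounded]. *)
exists (B * F' + 1); split.
- by rewrite ltr_wpDl// mulr_ge0.
- by move=> k; have [h1 h2] := cmeas_expiM (cphi k) (Ca k); exact: L2_bounded h1 h2.
move=> k l; rewrite /inner.
have -> : (fun x => expi (phi x k) * a x k * conjc (expi (phi x l) * a x l)) =
    (fun x => expi (phi x k - phi x l) * (a x k * conjc (a x l))).
  by apply/funext => x; rewrite rmorphM/= expiD expiN mulrACA.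
apply: le_trans (hB k l _ _ (Cboundedc_mul_conj (Ca k) (Ca l))) _.
by rewrite ler_wpM2r ?lattice_weight_ge0// lerDl.
Qed.

Lemma expi_int (z : int) (t : R) : expi (t + 2 * pi * z%:~R) = expi t.
Proof.
have H (m : nat) (s : R) : expi (s + 2 * pi * m%:R) = expi s.
  have -> : 2 * pi * m%:R = (pi *+ 2) *+ m :> R by rewrite mulr_natr mulr_natl.
  by rewrite /expi (periodicn (@cosD2pi R)) (periodicn (@sinD2pi R)).
case: z => m; first exact: H.
have := H m.+1 (t - 2 * pi * m.+1%:R).
by rewrite subrK NegzE mulrNz mulrN => ->.
Qed.

Lemma dot_shift (h : R) j (x : 'rV[R]_n) (k : lattice) :
  dot (h *: e_ j + x) k = h * (k ord0 j)%:~R + dot x k.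
Proof.
rewrite /dot (eq_bigr (fun i => h * (i == j)%:R * (k ord0 i)%:~R + x ord0 i * (k ord0 i)%:~R)).
  rewrite big_split/=; congr (_ + _); rewrite (bigD1 j)//= eqxx mulr1 big1 ?addr0// => i ij.
  by rewrite (negbTE ij) mulr0 mul0r.
by move=> i _; rewrite unit_vec_shiftE mulrDl.
Qed.

Lemma is_derive_dot j (x : 'rV[R]_n) (k : lattice) :
  is_derive x (e_ j) (fun x => dot x k) (k ord0 j)%:~R.
Proof.
have d1 : is_derive (0 : R) 1 (fun h : R => (k ord0 j)%:~R * h + dot x k) (k ord0 j)%:~R.
  by apply: is_derive_eq; rewrite addr0 [_ *: _]mulr1.
apply: is_derive_slice d1 => h.
by rewrite dot_shift [h *: 1]mulr1 addr0 [_ * h]mulrC.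
Qed.

Lemma dotB (x : 'rV[R]_n) (k l : lattice) : dot x k - dot x l = dot x (k - l).
Proof.
rewrite /dot -sumrB; apply: eq_bigr => j _.
by rewrite !mxE intrB; ring.
Qed.

Lemma nonstationary_dot : nonstationary 1 1 (@dot R n).
Proof.
have pd (j : 'I_n) (k : lattice) :
    partial j (fun y : 'rV[R]_n => dot y k) = fun=> (k ord0 j)%:~R.
  by apply/funext => x; rewrite /partial; have [_ ->] := is_derive_dot j x k.
split.
- move=> k; rewrite /dot; elim: (index_enum _) => [|j s IH].
    rewrite (_ : (fun x => _) = fun=> 0); first exact: cst_continuous.
    by apply/funext => x; rewrite big_nil.
  rewrite (_ : (fun x => _) = fun x : 'rV[R]_n => x ord0 j * (k ord0 j)%:~R +
    \sum_(i <- s) x ord0 i * (k ord0 i)%:~R); last first.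
    by apply/funext => x; rewrite big_cons.
  have cj : continuous (fun x : 'rV[R]_n => x ord0 j * (k ord0 j)%:~R).
    by apply: continuous_rVM; [exact: coord_continuous|exact: cst_continuous].
  by move=> x; exact: (continuousD (cj x) (IH x)).
- by move=> k j x; case: (is_derive_dot j x k).
- move=> k j x; rewrite addrC dot_shift addrC; exact: expi_int.
- move=> k l j; rewrite !pd mul1r; apply: Cbounded_cst.
  by have := ler_coord_enorm R (k - l) j; rewrite !mxE intrB.
- move=> k l x; rewrite mul1r enorm_latticeE le_eqVlt; apply/orP; left; apply/eqP.
  by apply: eq_bigr => j _; rewrite !pd !mxE intrB.
Qed.

End oscillatory_gram.

(** * Symbols and series *)

Section symbol_classes.
Context (R : realType) (n : nat).
Local Notation e_ j := (unit_vec R j).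
Local Notation lattice := ('rV[int]_n).
Implicit Types (f g : 'rV[R]_n -> R).

Lemma CdiffB m f g : Cdiff m f -> Cdiff m g -> Cdiff m (fun x => f x - g x).
Proof.
elim: m f g => [|m IH] f g [cf hf] [cg hg].
  by split=> // x; exact: (continuousB (cf x) (cg x)).
split=> [x|j]; first exact: (continuousB (cf x) (cg x)).
have [df Cf] := hf j; have [dg Cg] := hg j.
split; first by move=> x; exact: derivableB.
have -> : partial j (fun x => f x - g x) = fun x => partial j f x - partial j g x.
  by apply/funext => x; exact: deriveB.
exact: IH.
Qed.

Lemma partialwB w f g : Cdiff (size w) f -> Cdiff (size w) g ->
  partialw w (fun x => f x - g x) = fun x => partialw w f x - partialw w g x.
Proof.
elim/last_ind: w f g => [//|w j IH] f g; rewrite size_rcons => -[_ /(_ j)[df Cf]] [_ /(_ j)[dg Cg]].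
rewrite !partialw_rcons -IH//; congr partialw.
by apply/funext => x; exact: deriveB.
Qed.

Lemma rV_periodic_partialw w f : rV_periodic f -> rV_periodic (partialw w f).
Proof. by elim: w => [//|j w IH] pf; apply: rV_periodic_partial; exact: IH. Qed.

Lemma symbol_Cbounded m (M : R) f : Cdiff m f -> rV_periodic f ->
  (forall alpha, (msize alpha <= m)%N -> forall x, cube x ->
     `|mpartial alpha f x| <= M) ->
  Cbounded m M f.
Proof.
move=> Cf pf hf; apply: Cdiff_Cbounded => // w x sz.
have [y cy E] := rV_periodic_cube x.
rewrite (E _ (rV_periodic_partialw w pf)) -(mpartial_count Cf)//.
by apply: hf => //; rewrite msize_count.
Qed.

(** Neither [phi] nor its higher differences in [k] need be periodic, but differences of gradients
    are. So the point is first moved into the cube, and the bound on [diffk] is telescoped there. *)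
Lemma phase_nonstationary (C c : R) (phi : 'rV[R]_n -> lattice -> R) :
  (forall k, Cdiff (2 * n + 1) (fun x => phi x k)) ->
  (forall k, torus_periodic (fun x => expi (phi x k))) ->
  (forall alpha, (msize alpha <= 2 * n + 1)%N -> forall x k, cube x ->
     forall j, `|mpartial alpha (fun y => diffk j phi y k) x| <= C) ->
  0 < c -> (forall x k l, cube x -> c * enorm (latticeR R (k - l)) <=
     enorm (grad (fun y => phi y k) x - grad (fun y => phi y l) x)) ->
  nonstationary (C * n%:R) (c ^+ 2) phi.
Proof.
rewrite addn1 => Cphi pphi bphi c0 sphi.
have dphi k j x : derivable (fun x => phi x k) x (e_ j).
  by have [_ /(_ j)[]] := Cphi k.
have pd k j := partial_phase_periodic (dphi k j) (pphi k).
have pdd k l j : rV_periodic (fun x =>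
    partial j (fun y => phi y k) x - partial j (fun y => phi y l) x).
  by move=> i x; rewrite !pd.
split=> // [k|k l j|k l x].
- by have [] := Cphi k.
- have CB : Cdiff (2 * n) (fun x => partial j (fun y => phi y k) x - partial j (fun y => phi y l) x).
    by apply: CdiffB; [have [_ /(_ j)[]] := Cphi k|have [_ /(_ j)[]] := Cphi l].
  apply: Cdiff_Cbounded => // w x sz.
  have [y cy E] := rV_periodic_cube x.
  rewrite (E _ (rV_periodic_partialw w (pdd k l j))).
  rewrite partialwB; last 2 first.
    by apply: Cdiff_leq sz _; have [_ /(_ j)[]] := Cphi k.
    by apply: Cdiff_leq sz _; have [_ /(_ j)[]] := Cphi l.
  rewrite -!partialw_rcons.
  (* The letter [j] of the gradient is appended to [w]: at most [2n] derivatives of the gradient are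
     at most [2n + 1] derivatives of the phase. *)
  apply: (lattice_lipschitz (G := fun k => partialw (rcons w j) (fun y => phi y k) y)).
  move=> k' i.
  have szr : (size (rcons w j) <= (2 * n).+1)%N by rewrite size_rcons.
  have Ck q : Cdiff (size (rcons w j)) (fun y => phi y q) by exact: Cdiff_leq szr (Cphi q).
  have -> : partialw (rcons w j) (fun y => phi y (k' + delta_mx ord0 i)) y -
      partialw (rcons w j) (fun y => phi y k') y =
      partialw (rcons w j) (fun y => diffk i phi y k') y.
    by rewrite /diffk partialwB.
  rewrite -(mpartial_count (CdiffB (Cphi _) (Cphi _)))//.
  by apply: bphi => //; rewrite msize_count.
- pose S x := \sum_j (partial j (fun y => phi y k) x - partial j (fun y => phi y l) x) ^+ 2.
  have pS : rV_periodic S.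
    by move=> i z; apply: eq_bigr => j _; rewrite (pdd k l j).
  have [y cy E] := rV_periodic_cube x; rewrite -/(S x) (E _ pS).
  have := sphi y k l cy; rewrite -ler_sqr ?nnegrE ?enorm_ge0 ?mulr_ge0 ?enorm_ge0 ?(ltW c0)//.
  rewrite exprMn => /le_trans; apply; rewrite /enorm sqr_sqrtr.
    by rewrite /S; apply: ler_sum => j _; rewrite !mxE.
  by apply: sumr_ge0 => j _; exact: sqr_ge0.
Qed.

End symbol_classes.

(** * Unconditional sums over the lattice *)

Section lattice_sums.
Context (R : realType) (n : nat).
Local Notation lattice := ('rV[int]_n).
Implicit Types (F : lattice -> R[i]) (G : lattice -> R) (K J : {fset lattice}).

Lemma nonneg_lattice_sum G (D : R) : (forall k, 0 <= G k) ->
  (forall K, \sum_(k <- K) G k <= D) ->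
  exists s : R, forall e : R, 0 < e -> exists J, forall K, fsubset J K ->
    `|\sum_(k <- K) G k - s| < e.
Proof.
move=> G0 GD; pose A := range (fun K => \sum_(k <- K) G k).
have sA : has_sup A.
  by split; [exists (\sum_(k <- fset0%fset) G k), fset0%fset|exists D => _ [K _ <-]; exact: GD].
exists (sup A) => e e0; have [_ [J _ <-] hJ] := sup_adherent e0 sA.
exists J => K JK; have KA : \sum_(k <- K) G k <= sup A.
  by apply: sup_upper_bound => //; exists K.
have JKle : \sum_(k <- J) G k <= \sum_(k <- K) G k.
  by rewrite (fset_sum_split _ JK) lerDl sumr_ge0.
by rewrite distrC ger0_norm; lra.
Qed.

Lemma cRe_sum (r : seq lattice) F : Re (\sum_(k <- r) F k) = \sum_(k <- r) Re (F k).
Proof. by elim: r => [|k s IH]; rewrite ?big_nil// !big_cons cReD IH. Qed.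

Lemma cIm_sum (r : seq lattice) F : Im (\sum_(k <- r) F k) = \sum_(k <- r) Im (F k).
Proof. by elim: r => [|k s IH]; rewrite ?big_nil// !big_cons cImD IH. Qed.

(** Positive and negative parts reduce the claim to nonnegative families, whose sum is the supremum
    of the finite partial sums. *)
Let real_sum G F (D : R) : (forall k, `|G k| <= cnorm (F k)) ->
  (forall K, \sum_(k <- K) cnorm (F k) <= D) ->
  exists s : R, forall e : R, 0 < e -> exists J, forall K, fsubset J K ->
    `|\sum_(k <- K) G k - s| < e.
Proof.
move=> GF FD.
have [|K|s1 h1] := @nonneg_lattice_sum (fun k => Num.max (G k) 0) D.
- by move=> k; rewrite le_max lexx orbT.
- apply: le_trans (FD K); apply: ler_sum => k _.
  by rewrite ge_max cnorm_ge0 andbT (le_trans (ler_norm _)).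
have [|K|s2 h2] := @nonneg_lattice_sum (fun k => Num.max (- G k) 0) D.
- by move=> k; rewrite le_max lexx orbT.
- apply: le_trans (FD K); apply: ler_sum => k _.
  by rewrite ge_max cnorm_ge0 andbT (le_trans (ler_norm _))// normrN.
exists (s1 - s2) => e e0; have e2 : 0 < e / 2 by lra.
have [J1 H1] := h1 _ e2; have [J2 H2] := h2 _ e2.
exists (J1 `|` J2)%fset => K; rewrite fsubUset => /andP[/H1 k1 /H2 k2].
have -> : \sum_(k <- K) G k =
    \sum_(k <- K) Num.max (G k) 0 - \sum_(k <- K) Num.max (- G k) 0.
  rewrite -sumrB; apply: eq_bigr => k _.
  by case: (leP (G k) 0) => g0; case: (leP (- G k) 0) => g1; lra.
set X := \sum_(k <- K) _ in k1 *; set Y := \sum_(k <- K) _ in k2 *.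
rewrite (_ : X - Y - (s1 - s2) = (X - s1) - (Y - s2)); last by ring.
by apply: le_lt_trans (ler_normB _ _) _; lra.
Qed.

Lemma lattice_sum_exists F (D : R) :
  (forall K, \sum_(k <- K) cnorm (F k) <= D) -> exists s, lattice_sum F s.
Proof.
move=> FD.
have [sr hr] := real_sum (fun k => normr_Re (F k)) FD.
have [si hi] := real_sum (fun k => normr_Im (F k)) FD.
exists (sr +i* si) => e e0; have e2 : 0 < e / 2 by lra.
have [J1 H1] := hr _ e2; have [J2 H2] := hi _ e2.
exists (J1 `|` J2)%fset => K; rewrite fsubUset => /andP[/H1 k1 /H2 k2].
apply: le_lt_trans (cnorm_le_ReIm _) _.
rewrite cReD cImD cReN cImN cRe_sum cIm_sum /=; lra.
Qed.

Lemma lattice_sum_exhaustion F s : lattice_sum F s ->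
  forall e : R, 0 < e -> exists N, forall m, (N <= m)%N ->
    cnorm (\sum_(k <- exhaustion n m) F k - s) < e.
Proof.
move=> hs e /hs[J hJ]; have [N hN] := exhaustion_exists J.
by exists N => m /hN; exact: hJ.
Qed.

Lemma lattice_sum_cvg F s : lattice_sum F s ->
  (fun m => Re (\sum_(k <- exhaustion n m) F k)) @ \oo --> Re s /\
  (fun m => Im (\sum_(k <- exhaustion n m) F k)) @ \oo --> Im s.
Proof.
move=> hs; split; apply/cvgrPdist_lt => e e0.
- have [N hN] := lattice_sum_exhaustion hs e0; exists N => // m Nm /=.
  rewrite distrC -cReN -cReD; exact: le_lt_trans (normr_Re _) (hN m Nm).
- have [N hN] := lattice_sum_exhaustion hs e0; exists N => // m Nm /=.
  rewrite distrC -cImN -cImD; exact: le_lt_trans (normr_Im _) (hN m Nm).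
Qed.

Lemma lattice_sum_le F s (D : R) : lattice_sum F s ->
  (forall K, \sum_(k <- K) cnorm (F k) <= D) -> cnorm s <= D.
Proof.
move=> hs FD; apply/ler_addgt0Pr => e e0; have [J /(_ J (fsubset_refl _)) h] := hs _ e0.
have -> : s = \sum_(k <- J) F k + - (\sum_(k <- J) F k - s) by rewrite opprB addrC subrK.
apply: le_trans (cnorm_triangle _ _) _; apply: lerD.
  exact: le_trans (cnorm_sum _ _) (FD J).
by rewrite [cnorm _]normcN ltW.
Qed.

End lattice_sums.

(** * Fourier integral operators *)

Section fourier_integral_operator.
Context (R : realType) (n : nat).
Local Notation mu := (torus_measure R n).
Local Notation lattice := ('rV[int]_n).
Local Notation weight := (@lattice_weight R n).
Local Notation J := (@exhaustion n).
Implicit Types (f g : 'rV[R]_n -> R[i]) (K : {fset lattice}).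

Lemma Cboundedc_cmeas m (F : R) f : Cboundedc m F f -> cmeas f.
Proof.
by move=> [fr fi _]; split; apply: continuous_measurable_rV;
  [exact: Cbounded_continuous fr|exact: Cbounded_continuous fi].
Qed.

Lemma Cboundedc_le m (F : R) f : Cboundedc m F f -> forall x, cnorm (f x) <= F + F.
Proof.
move=> [fr fi _] x; apply: le_trans (cnorm_le_ReIm _) _; apply: lerD.
  exact: Cbounded_le fr x.
exact: Cbounded_le fi x.
Qed.

Lemma Cboundedc_L2 m (F : R) f : Cboundedc m F f -> L2 f.
Proof.
by move=> Cf; apply: L2_bounded (Cboundedc_le Cf); exact: Cboundedc_cmeas Cf.
Qed.

Lemma torus_smooth_Cboundedc (u : torus_smooth R n) m : exists F : R, Cboundedc m F u.
Proof.
have pu := smooth_periodic u; have [pr pi_] := torus_periodic_Re_Im pu.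
have [cr ci] := smooth_Cdiffc u m.
have [M1 h1] := Cdiff_periodic_Cbounded cr pr.
have [M2 h2] := Cdiff_periodic_Cbounded ci pi_.
exists (Num.max M1 M2); split=> //.
  by apply: Cbounded_weak h1; rewrite le_max lexx.
by apply: Cbounded_weak h2; rewrite le_max lexx orbT.
Qed.

Lemma cmeasM f g : cmeas f -> cmeas g -> cmeas (fun x => f x * g x).
Proof.
move=> [fr fi] [gr gi]; split.
- rewrite (_ : (fun x => _) = (fun x => Re (f x) * Re (g x) - Im (f x) * Im (g x))).
    by apply: measurable_funB; exact: measurable_funM.
  by apply/funext => x; rewrite cReM.
- rewrite (_ : (fun x => _) = (fun x => Re (f x) * Im (g x) + Im (f x) * Re (g x))).
    by apply: measurable_funD; exact: measurable_funM.
  by apply/funext => x; rewrite cImM.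
Qed.

Lemma torus_integrable_cmeas f : torus_integrable f -> cmeas f.
Proof. by move=> [/measurable_int fr /measurable_int fi]; split; apply/measurable_EFinP. Qed.

Lemma torus_int_ae f g : cmeas f -> cmeas g -> {ae mu, forall x, f x = g x} ->
  torus_int f = torus_int g.
Proof.
move=> [fr fi] [gr gi] fg; apply: complex_ReIm_eq; rewrite /torus_int/= /Rintegral; congr fine;
  apply: ae_eq_integral => //; try exact/measurable_EFinP;
  by apply: filterS fg => x /= -> _.
Qed.

Lemma cmeas_bounded_integrable f (M : R) : cmeas f -> (forall x, cnorm (f x) <= M) ->
  torus_integrable f.
Proof. by move=> mf fM; apply: L2_integrable; exact: L2_bounded mf fM. Qed.

Lemma cnorm_torus_int_le f (M : R) : cmeas f -> (forall x, cnorm (f x) <= M) ->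
  cnorm (torus_int f) <= 2 * (M * fine (mu setT)).
Proof.
move=> [fr fi] fM; apply: le_trans (cnorm_le_ReIm _) _.
rewrite mulr_natl mulr2n; apply: lerD; apply: le_Rintegral_torus => // x.
  exact: le_trans (normr_Re _) (fM x).
exact: le_trans (normr_Im _) (fM x).
Qed.

(** The factor 1 is the amplitude, kept so that the family has the shape treated by
    [nonstationary_gram]. *)
Definition plane_wave (k : lattice) (x : 'rV[R]_n) : R[i] := expi (dot x k) * 1.

Lemma Cboundedc_1 m : Cboundedc m 1 (fun _ : 'rV[R]_n => 1 : R[i]).
Proof.
by split => //; apply: Cbounded_cst; rewrite ?normr1 ?normr0.
Qed.

Lemma plane_wave_gram : exists B, gram_bounded plane_wave B.
Proof.
exact: (nonstationary_gram ler01 ltr01 (@nonstationary_dot R n)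
  (a := fun _ _ => 1) (fun _ => Cboundedc_1 _)).
Qed.

Local Notation kappa := (((2 * pi) ^- n)%:C : R[i]).

Lemma fourierE f k : L2 f -> fourier f k = kappa * inner f (plane_wave k).
Proof.
move=> Lf; have [B [_ LE _]] := plane_wave_gram.
have [_] := torus_integrable_lin kappa (L2_mul_conj Lf (LE k)) (@torus_integrable0 R n).
rewrite torus_int0 addr0 /inner => <-; congr torus_int; apply/funext => x.
by rewrite addr0 /plane_wave mulr1 -expiN; ring.
Qed.

(** Up to the constant [kappa], the coefficient is the oscillatory integral with amplitude [u] and
    phase [0 . x - k . x], that is, the entry of the phase estimate for the pair [0], [k]. *)
Lemma fourier_decay (u : torus_smooth R n) :
  exists2 D : R, 0 <= D & forall k, cnorm (fourier u k) <= D * weight k.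
Proof.
have [M CM] := torus_smooth_Cboundedc u (2 * n).
have [B B0 hB] := nonstationary_decay ler01 ltr01 (@nonstationary_dot R n).
have M0 : 0 <= M by have [h _ _] := CM; exact: Cbounded_ge0 h.
exists (cnorm kappa * (B * M)); first by rewrite !mulr_ge0// cnorm_ge0.
move=> k; rewrite fourierE; last exact: Cboundedc_L2 CM.
rewrite cnormM -mulrA ler_wpM2l ?cnorm_ge0//.
have := hB 0 k M u CM; rewrite sub0r lattice_weightN; apply: le_trans.
rewrite /inner le_eqVlt; apply/orP; left; apply/eqP; congr (cnorm (torus_int _)).
apply/funext => x; have -> : dot x 0 = 0 :> R.
  by rewrite -(subrr (0 : lattice)) -dotB subrr.
by rewrite sub0r /plane_wave mulr1 -expiN mulrC.
Qed.

Variables (phi : 'rV[R]_n -> lattice -> R) (a : 'rV[R]_n -> lattice -> R[i]) (F : R).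
Hypothesis cphi : forall k, continuous (fun x => phi x k).
Hypothesis Ca : forall k, Cboundedc (2 * n) F (fun x => a x k).

Let F0 : 0 <= F.
Proof. by have [h _ _] := Ca 0; exact: Cbounded_ge0 h. Qed.

Let term_cmeas (b : R[i]) k : cmeas (fun x => expi (phi x k) * a x k * b).
Proof.
have [h _] := cmeas_expiM (@cphi k) (Ca k).
apply: cmeasM => //; split; exact: measurable_cst.
Qed.

(** The amplitudes are bounded by [F + F] and the coefficients by a multiple of the weight, so the
    series converges absolutely, with one bound at all points. Measurability comes from the partial
    sums over the exhaustion. *)
Let fio_sum_exists (u : torus_smooth R n) : exists2 Tu : 'rV[R]_n -> R[i],
  forall x, lattice_sum (fun k => expi (phi x k) * a x k * fourier u k) (Tu x) &
  cmeas Tu /\ exists D : R, forall x, cnorm (Tu x) <= D.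
Proof.
have [D0 D00 hD0] := fourier_decay u.
pose D := (F + F) * (D0 * 8 ^+ n).
have hD x K : \sum_(k <- K) cnorm (expi (phi x k) * a x k * fourier u k) <= D.
  apply: (@le_trans _ _ (\sum_(k <- K) (F + F) * (D0 * weight k))).
    apply: ler_sum => k _; rewrite !cnormM cnorm_expi mul1r.
    apply: ler_pM; rewrite ?cnorm_ge0// ?hD0//; exact: Cboundedc_le (Ca k) x.
  rewrite -!mulr_sumr /D !ler_wpM2l ?addr_ge0//.
  have := sum_lattice_weight R K 0; apply: le_trans.
  by apply: ler_sum => k _; rewrite subr0.
have /choice[Tu hTu] : forall x, exists s,
    lattice_sum (fun k => expi (phi x k) * a x k * fourier u k) s.
  by move=> x; exact: lattice_sum_exists (hD x).
exists Tu => //; split; last by exists D => x; exact: lattice_sum_le (hTu x) (hD x).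
have tm k := term_cmeas (fourier u k) k.
split.
- apply: (@measurable_fun_cvg _ _ _ setT
    (fun m x => Re (\sum_(k <- J m) expi (phi x k) * a x k * fourier u k))).
    move=> m; under eq_fun do rewrite cRe_sum.
    by apply: measurable_sum => k; case: (tm k).
  by move=> x _; have [] := lattice_sum_cvg (hTu x).
- apply: (@measurable_fun_cvg _ _ _ setT
    (fun m x => Im (\sum_(k <- J m) expi (phi x k) * a x k * fourier u k))).
    move=> m; under eq_fun do rewrite cIm_sum.
    by apply: measurable_sum => k; case: (tm k).
  by move=> x _; have [] := lattice_sum_cvg (hTu x).
Qed.

Let mpartial0 (f : 'rV[R]_n -> R) : mpartial (fun=> 0%N) f = f.
Proof. by rewrite /mpartial; elim: (enum _) => [//|j s /= ->]. Qed.

Lemma bounded_distribution g (D : R) : cmeas g -> (forall x, cnorm (g x) <= D) ->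
  exists L : torus_distribution R n, is_function L g.
Proof.
move=> mg gD; have D0 : 0 <= D by exact: le_trans (cnorm_ge0 _) (gD 0).
have sm (v : torus_smooth R n) : cmeas v.
  by have [M CM] := torus_smooth_Cboundedc v 0; exact: Cboundedc_cmeas CM.
have ig (v : torus_smooth R n) : torus_integrable (fun x => g x * v x).
  have [M CM] := torus_smooth_Cboundedc v 0.
  apply: (@cmeas_bounded_integrable _ (D * (M + M))); first exact: cmeasM.
  by move=> x; rewrite cnormM ler_pM ?cnorm_ge0//; exact: Cboundedc_le CM x.
have lin (c : R[i]) (u v w : torus_smooth R n) : (forall x, w x = c * u x + v x) ->
    torus_int (fun x => g x * w x) =
    c * torus_int (fun x => g x * u x) + torus_int (fun x => g x * v x).
  move=> hw; have [_ <-] := torus_integrable_lin c (ig u) (ig v).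
  by congr torus_int; apply/funext => x; rewrite hw; ring.
have cont (v_ : nat -> torus_smooth R n) (v : torus_smooth R n) : smooth_cvg v_ v ->
    (fun i => cnorm (torus_int (fun x => g x * v_ i x) -
       torus_int (fun x => g x * v x))) @ \oo --> (0 : R).
  move=> hv; apply/cvgrPdist_lt => e e0.
  pose m := fine (mu setT); have m0 : 0 <= m by exact: fine_ge0.
  (* A deviation of at most [e / q] changes the pairing by at most [2 D m e / q], which is strictly
     below [e]; the summand 1 also keeps [q] positive. *)
  pose q := 2 * (D * m) + 1.
  have q0 : 0 < q by rewrite ltr_wpDl// !mulr_ge0.
  have eq0 : 0 < e / q by rewrite divr_gt0.
  have := hv (fun=> 0%N) _ eq0; apply: filterS => i hi.
  rewrite sub0r normrN ger0_norm ?cnorm_ge0//.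
  have -> : torus_int (fun x => g x * v_ i x) - torus_int (fun x => g x * v x) =
      torus_int (fun x => g x * (v_ i x - v x)).
    have [_] := torus_integrable_lin (-1) (ig v) (ig (v_ i)).
    rewrite mulN1r addrC => <-; congr torus_int; apply/funext => x; ring.
  apply: le_lt_trans (cnorm_torus_int_le (M := D * (e / q)) _ _) _.
  - apply: cmeasM => //; have := cmeas_lin (-1) (sm v) (sm (v_ i)).
    by under eq_fun do rewrite mulN1r addrC.
  - move=> x; rewrite cnormM ler_pM ?cnorm_ge0//.
    have := hi x; rewrite /mpartialc !mpartial0.
    by case: (v_ i x) => ? ?; case: (v x).
  - rewrite -/m (_ : 2 * _ = 2 * (D * m) * e / q); last by ring.
    rewrite ltr_pdivrMr// [e * q]mulrC ltr_pM2r// /q ltrDl ltr01 //.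
exists (TorusDistribution lin cont); split=> //.
exact: cmeas_bounded_integrable gD.
Qed.

(** Ensures that the quantification over all [T] in the second half of the theorem is not
    vacuous. *)
Lemma fio_exists : exists T : torus_smooth R n -> torus_distribution R n, is_fio phi a T.
Proof.
have /choice[T hT] : forall u : torus_smooth R n, exists L : torus_distribution R n,
    exists Tu : 'rV[R]_n -> R[i],
    (forall x, lattice_sum (fun k => expi (phi x k) * a x k * fourier u k) (Tu x)) /\
    is_function L Tu.
  move=> u; have [Tu hTu [mTu [D TuD]]] := fio_sum_exists u.
  by have [L hL] := bounded_distribution mTu TuD; exists L, Tu.
by exists T.
Qed.

(** The operator [T] is known only through its series. The function [Tu] and the value [S u] are
    limits of the same partial sums over the exhaustion, so they define the same distribution once
    they are shown to agree almost everywhere. *)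
Lemma fio_extends (B : R) (T : torus_smooth R n -> torus_distribution R n) :
  gram_bounded (fun k x => expi (phi x k) * a x k) B -> is_fio phi a T ->
  extends_to_bounded_L2 T.
Proof.
move=> gA hT; have [B' gE] := plane_wave_gram.
have [S [bS hS]] := analysis_synthesis_bounded kappa gA gE.
exists S; split=> // u.
have [M CM] := torus_smooth_Cboundedc u 0.
have Lu : L2 u by exact: Cboundedc_L2 CM.
have [LSu hSu] := hS u Lu.
have [Tu [sTu [iTu TuL]]] := hT u.
have mTu := torus_integrable_cmeas iTu.
have mSu := L2_cmeas LSu.
pose s m x := \sum_(k <- J m) kappa * inner u (plane_wave k) * (expi (phi x k) * a x k).
have sE m x : s m x = \sum_(k <- J m) expi (phi x k) * a x k * fourier u k.
  by apply: eq_bigr => k _; rewrite fourierE// mulrC.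
have ms m : cmeas (s m) by apply: L2_cmeas; apply: L2_sum; case: gA.
have [[sr si] [tr ti]] := (mSu, mTu).
have zeroR : sqint mu (fun x => Re (S u x) - Re (Tu x)) = 0%E.
  apply/eqP; rewrite eq_le sqint_ge0 andbT; apply/lee_addgt0Pr => e e0; rewrite add0e.
  apply: (@sqint_fatou _ _ _ _ (fun m x => Re (S u x) - Re (s m x))).
  - by move=> m; apply: measurable_funB => //; case: (ms m).
  - move=> x; apply: cvgB; first exact: cvg_cst.
    have [+ _] := lattice_sum_cvg (sTu x).
    by under eq_fun do rewrite -sE.
  - have [N hN] := hSu e e0; exists N => m /hN; apply: le_trans.
    rewrite /csqint (_ : (fun x => Re _) = (fun x => Re (S u x) - Re (s m x))).
      exact: leeDl (sqint_ge0 _ _).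
    by apply/funext => x; rewrite cReD cReN.
have zeroI : sqint mu (fun x => Im (S u x) - Im (Tu x)) = 0%E.
  apply/eqP; rewrite eq_le sqint_ge0 andbT; apply/lee_addgt0Pr => e e0; rewrite add0e.
  apply: (@sqint_fatou _ _ _ _ (fun m x => Im (S u x) - Im (s m x))).
  - by move=> m; apply: measurable_funB => //; case: (ms m).
  - move=> x; apply: cvgB; first exact: cvg_cst.
    have [_ +] := lattice_sum_cvg (sTu x).
    by under eq_fun do rewrite -sE.
  - have [N hN] := hSu e e0; exists N => m /hN; apply: le_trans.
    rewrite /csqint (_ : (fun x => Im _) = (fun x => Im (S u x) - Im (s m x))).
      exact: leeDr (sqint_ge0 _ _).
    by apply/funext => x; rewrite cImD cImN.
have ae : {ae mu, forall x, Tu x = S u x}.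
  have hr := sqint_eq0 (measurable_funB sr tr) zeroR.
  have hi := sqint_eq0 (measurable_funB si ti) zeroI.
  apply: filterS2 hr hi => x /eqP; rewrite subr_eq0 => /eqP hr /eqP.
  by rewrite subr_eq0 => /eqP hi; exact: complex_ReIm_eq.
split; first exact: L2_integrable.
move=> v; rewrite TuL.
have [M' CM'] := torus_smooth_Cboundedc v 0.
have mv := Cboundedc_cmeas CM'.
apply: torus_int_ae; [exact: cmeasM|exact: cmeasM|].
by apply: filterS ae => x ->.
Qed.

End fourier_integral_operator.

Theorem theorem9p2 (R : realType) (n : nat)
    (phi : 'rV[R]_n -> 'rV[int]_n -> R)
    (a : 'rV[R]_n -> 'rV[int]_n -> R[i])
    (a_periodic : forall k, torus_periodic (fun x => a x k))
    (phi_C : forall k, Cdiff (2 * n + 1) (fun x => phi x k))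
    (a_C : forall k, Cdiffc (2 * n + 1) (fun x => a x k))
    (expi_phi_periodic : forall k, torus_periodic (fun x => expi (phi x k)))
    (symbol_bounds : exists2 C : R, 0 < C &
      forall alpha : 'I_n -> nat, (msize alpha <= 2 * n + 1)%N ->
      forall (x : 'rV[R]_n) (k : 'rV[int]_n), cube x ->
        cnorm (mpartialc alpha (fun y => a y k) x) <= C /\
        forall j, `|mpartial alpha (fun y => diffk j phi y k) x| <= C)
    (grad_phi_separated : exists2 C : R, 0 < C &
      forall (x : 'rV[R]_n) (k l : 'rV[int]_n), cube x ->
        C * enorm (latticeR R (k - l)) <=
        enorm (grad (fun y => phi y k) x - grad (fun y => phi y l) x)) :
  (exists T : torus_smooth R n -> torus_distribution R n, is_fio phi a T) /\
  forall T : torus_smooth R n -> torus_distribution R n,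
    is_fio phi a T -> extends_to_bounded_L2 T.
Proof.
have [C C0 hC] := symbol_bounds; have [c c0 hc] := grad_phi_separated.
(* The factor [n] comes from telescoping along lattice paths; [c] is squared because [nonstationary]
   compares squared norms. *)
have ns : nonstationary (C * n%:R) (c ^+ 2) phi.
  apply: phase_nonstationary hc => // alpha sz x k cx j.
  by have [_ ->] := hC alpha sz x k cx.
have Ca k : Cboundedc (2 * n) C (fun x => a x k).
  have [pr pi_] := torus_periodic_Re_Im (a_periodic k); have [cr ci] := a_C k.
  have le_n : (2 * n <= 2 * n + 1)%N by rewrite leq_addr.
  split=> //; apply: Cbounded_leq le_n _; apply: symbol_Cbounded => // alpha sz x cx.
    have [h _] := hC alpha sz x k cx.
    exact: le_trans (normr_Re (mpartialc alpha (fun y => a y k) x)) h.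
  have [h _] := hC alpha sz x k cx.
  exact: le_trans (normr_Im (mpartialc alpha (fun y => a y k) x)) h.
have Cn0 : 0 <= C * n%:R by rewrite mulr_ge0// ltW.
have [B gA] := nonstationary_gram Cn0 (exprn_gt0 2 c0) ns Ca.
have [cphi _ _ _ _] := ns.
split; first exact: fio_exists cphi Ca.
by move=> T; exact: fio_extends gA.
Qed.
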